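(* \textsc{1-Edge Contraction($\gamma_{t2}$)} is $\mathsf{coNP}$-hard when restricted to claw-free graphs.
   Context: All graphs are finite, simple and connected. A semitotal dominating set of $G$ is a set $D\subseteq V(G)$ such that every vertex outside $D$ has a neighbour in $D$ and every vertex of $D$ is at distance at most two from another vertex of $D$; $\gamma_{t2}(G)$ is its minimum size. $ct_{\gamma_{t2}}(G)$ is the smallest $k$ such that contracting some $k$ edges of $G$ (an edge contraction of $uv$ replaces $u,v$ by a single vertex adjacent to all neighbours of $u$ or $v$) yields $G'$ with $\gamma_{t2}(G')<\gamma_{t2}(G)$. \textsc{1-Edge Contraction($\gamma_{t2}$)}: given $G$, decide whether $ct_{\gamma_{t2}}(G)\leq 1$. The claw is $K_{1,3}$; claw-free means no induced claw. *)

(* Defs.v *)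
From mathcomp Require Import all_boot.
Set Implicit Arguments. Unset Strict Implicit. Unset Printing Implicit Defensive.

(* A graph is given by a vertex set V : {set T} and an adjacency relation
   adj : rel T (symmetric, irreflexive on the graphs we use). *)

Definition semitotal_dom (T : finType) (V : {set T}) (adj : rel T)
    (D : {set T}) : bool :=
  [&& D \subset V,
      [forall x in V :\: D, [exists y in D, adj x y]] &
      [forall x in D, [exists y in D,
          (y != x) && (adj x y || [exists z in V, adj x z && adj z y])]]].

(* gamma_t2 = minimum size of a semitotal dominating set.  If there is none,
   the value is the sentinel #|T|.+1 (larger than any set size). *)
Definition gamma_t2 (T : finType) (V : {set T}) (adj : rel T) : nat :=
  \big[minn/#|T|.+1]_(D : {set T} | semitotal_dom V adj D) #|D|.

(* Contraction of the edge uv: v is removed, and u (the merged vertex)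
   becomes adjacent to all neighbours of u or v (other than itself). *)
Definition contract_adj (T : finType) (adj : rel T) (u v : T) : rel T :=
  fun x y => (x != y) &&
    (if x == u then adj u y || adj v y
     else if y == u then adj x u || adj x v
     else adj x y).

(* ct_{gamma_t2}(G) <= 1: some single edge contraction decreases gamma_t2
   (contracting 0 edges never decreases it). *)
Definition ct_gt2_le1 (T : finType) (V : {set T}) (adj : rel T) : bool :=
  [exists u in V, exists v in V,
     adj u v && (gamma_t2 (V :\ v) (contract_adj adj u v) < gamma_t2 V adj)].

Definition simple_graph (n : nat) (adj : rel 'I_n) : Prop :=
  irreflexive adj /\ symmetric adj.

Definition connected_graph (n : nat) (adj : rel 'I_n) : Prop :=
  forall x y : 'I_n, connect adj x y.

Definition claw_free (n : nat) (adj : rel 'I_n) : Prop :=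
  ~ exists x a b c : 'I_n,
      [&& adj x a, adj x b, adj x c, a != b, a != c, b != c,
          ~~ adj a b, ~~ adj a c & ~~ adj b c].

Definition enc_graph (n : nat) (adj : rel 'I_n) : seq bool :=
  nseq n true ++ false :: [seq adj i j | i <- enum 'I_n, j <- enum 'I_n].

Inductive move := MoveL | MoveR | Stay.

Record TM := MkTM {
  tm_state : finType;
  tm_sym : finType;
  tm_blank : tm_sym;
  tm_b0 : tm_sym;
  tm_b1 : tm_sym;
  tm_start : tm_state;
  tm_halt : pred tm_state;
  tm_delta : tm_state -> tm_sym -> tm_state * tm_sym * move
}.

(* configuration: state, left part of tape (reversed, nearest cell first),
   symbol under the head, right part of tape; cells beyond are blank *)
Definition config (M : TM) : Type :=
  (tm_state M * seq (tm_sym M) * tm_sym M * seq (tm_sym M))%type.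

Definition tm_step (M : TM) (c : config M) : config M :=
  let: (q, l, h, r) := c in
  if @tm_halt M q then c else
  let: (q', s, m) := @tm_delta M q h in
  match m with
  | Stay => (q', l, s, r)
  | MoveL => match l with
             | [::] => (q', [::], @tm_blank M, s :: r)
             | a :: l' => (q', l', a, s :: r)
             end
  | MoveR => match r with
             | [::] => (q', s :: l, @tm_blank M, [::])
             | a :: r' => (q', s :: l, a, r')
             end
  end.

Definition tm_run (M : TM) (t : nat) (c : config M) : config M :=
  iter t (@tm_step M) c.

Definition bit_sym (M : TM) (b : bool) : tm_sym M :=
  if b then @tm_b1 M else @tm_b0 M.

Definition tm_init (M : TM) (x : seq bool) : config M :=
  match map (@bit_sym M) x with
  | [::] => (@tm_start M, [::], @tm_blank M, [::])
  | s :: r => (@tm_start M, [::], s, r)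
  end.

Fixpoint read_bits (M : TM) (s : seq (tm_sym M)) : seq bool :=
  match s with
  | [::] => [::]
  | a :: s' => if a == @tm_b1 M then true :: read_bits s'
               else if a == @tm_b0 M then false :: read_bits s'
               else [::]
  end.

Definition tm_output (M : TM) (c : config M) : seq bool :=
  let: (_, _, h, r) := c in read_bits (h :: r).

Definition tm_state_of (M : TM) (c : config M) : tm_state M :=
  let: (q, _, _, _) := c in q.

Definition poly_time (f : seq bool -> seq bool) : Prop :=
  exists (M : TM) (k : nat),
    [&& @tm_blank M != @tm_b0 M, @tm_blank M != @tm_b1 M & @tm_b0 M != @tm_b1 M] /\
    forall x : seq bool, exists t : nat,
      t <= k * (size x).+1 ^ k /\
      @tm_halt M (tm_state_of (tm_run t (tm_init M x))) /\
      tm_output (tm_run t (tm_init M x)) = f x.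

Definition language := seq bool -> Prop.

Definition in_P (L : language) : Prop :=
  exists f, poly_time f /\ forall x, L x <-> f x = [:: true].

Definition enc_pair (x y : seq bool) : seq bool :=
  flatten [seq [:: b; b] | b <- x] ++ [:: false; true] ++ y.

Definition in_NP (L : language) : Prop :=
  exists (Ver : language) (k : nat), in_P Ver /\
    forall x, L x <-> exists w : seq bool,
      size w <= k * (size x).+1 ^ k /\ Ver (enc_pair x w).

Definition in_coNP (L : language) : Prop := in_NP (fun x => ~ L x).

(* Main.v *)
(* Encode the runs of the verifier by a grid of cells whose values must avoid
   conflicting pairs, and let G be the line graph of a multigraph with loops
   which has, for each cell v, one node for each of the r values of v and r - 1
   selector nodes; its edges are a loop at every selector, all selector-value
   edges of v, and one edge per conflicting pair of values. Line graphs are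
   claw-free. Dominating the N selector loops takes N edges, one at each
   selector; such a choice misses at least one value of every cell, and it
   dominates G only if the missed values are conflict-free. So gamma_t2(G) = N if
   the verifier accepts some witness and gamma_t2(G) > N otherwise. All values of
   a cell conflict pairwise, whence no contraction goes below N. Acceptance is
   checked at one cell only, so one more edge there always suffices, and that
   edge is absorbed by contracting it into an adjacent chosen edge: some
   contraction always attains N. Hence ct <= 1 exactly when no witness is
   accepted. The adjacency matrix is printed by nested loops over polynomially
   bounded counters, which a one-tape machine simulates by marking, for each
   counter, the cell whose index is its value. *)

Require Import Defs.
From mathcomp Require Import all_boot.
From mathcomp Require Import zify.
From Stdlib Require Import Classical.
Set Implicit Arguments. Unset Strict Implicit. Unset Printing Implicit Defensive.

(** * Line graphs of conflict multigraphs *)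

(** What shapes the construction is that a contraction must reach N when the grid is unsatisfiable
    and must not go below N when it is satisfiable. A set of fewer than N edges for a contraction
    lifts to a dominating set of N edges of G. If it contains the merged vertex, the lift contains
    two edges that meet; they lie in one cell and cover the same value, so two values of that cell
    are missed and the conflict edge between them is not dominated. Otherwise at most one vertex
    needed the added edge, and a selector-value edge leading from the selector of that edge to a
    missed value is left undominated. The semitotal condition is free: the chosen edges at two
    selectors of one cell are at distance two. The tableau is drawn relative to the head so that the
    rule at a position never depends on where the head is. Adjacency is then a fixed Boolean
    function of finitely many comparisons of rows and columns and one input bit per cell, and the
    printing program keeps the outcomes of these tests in its control. *)

Section GammaT2.
Variables (T : finType) (V : {set T}) (adj : rel T).

Lemma gamma_t2_le (D : {set T}) : semitotal_dom V adj D -> gamma_t2 V adj <= #|D|.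
Proof.
move=> sD; rewrite /gamma_t2; have : D \in index_enum {set T} by rewrite mem_index_enum.
elim: (index_enum _) => // D' r IH; rewrite inE big_cons => /orP[/eqP<-|/IH le].
  by rewrite sD geq_minl.
by case: ifP => // _; rewrite geq_min le orbT.
Qed.

(** The first hypothesis covers the sentinel value of an empty minimum. *)
Lemma gamma_t2_geP (N : nat) : N <= #|T|.+1 ->
  (forall D : {set T}, semitotal_dom V adj D -> N <= #|D|) -> N <= gamma_t2 V adj.
Proof.
move=> NT ND; rewrite /gamma_t2; apply: (big_ind (fun x => N <= x)) => //.
by move=> x y Nx Ny; rewrite leq_min Nx.
Qed.
End GammaT2.

(** All variables have the same slots, so that vertices can be numbered by mixed-radix arithmetic.
    This is why absent conflicts are filled in rather than left out. *)
Definition slot (A : finType) : finType :=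
  (A + A * option A + option bool * option A * option A)%type.
(** Taking [option A] for the values gives exactly one value more than there are selectors. *)
Definition label (A : finType) : finType := (A + option A)%type.

(* The root multigraph has, for each variable [v], selector nodes [(v, inl s)]
   and value nodes [(v, inr a)]; slots of [v] name its edges: a loop at each
   selector, all selector-value edges, and one edge per conflicting pair of
   values (an absent conflict is replaced by a loop at the selector [a0]). *)
Definition slot_src (A : finType) (a0 : A)
    (cf : option bool -> option A -> option A -> bool) (k : slot A) : label A :=
  match k with
  | inl (inl s) => inl s
  | inl (inr (s, _)) => inl s
  | inr (d, a, b) => if cf d a b then inr a else inl a0
  end.

Definition slot_tgt (A : finType) (a0 : A)
    (cf : option bool -> option A -> option A -> bool) (k : slot A) :
    option bool * label A :=
  match k with
  | inl (inl s) => (None, inl s)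
  | inl (inr (_, a)) => (None, inr a)
  | inr (d, a, b) => if cf d a b then (d, inr b) else (None, inl a0)
  end.

(** For fixed [a], a bijection from the selectors onto the values other than [a]: [None] fills the
    place of the skipped value. *)
Definition skip_value (A : finType) (a : option A) (s : A) : option A :=
  if a == Some s then None else Some s.

Section ConflictGraph.
Variables (V A E : finType) (a0 a1 : A).
Variable nb : V -> option bool -> V.
Variable conf : V -> option bool -> option A -> option A -> bool.
Variables (var : E -> V) (slt : E -> slot A) (mk : V -> slot A -> E).
Hypothesis a01 : a0 != a1.
Hypothesis nb_self : forall v, nb v None = v.
Hypothesis conf_self : forall v a b, a != b -> conf v None a b.
Hypothesis mk_var : forall v k, var (mk v k) = v.
Hypothesis mk_slt : forall v k, slt (mk v k) = k.

Definition esrc (e : E) : V * label A := (var e, slot_src a0 (conf (var e)) (slt e)).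
Definition etgt (e : E) : V * label A :=
  let: (d, l) := slot_tgt a0 (conf (var e)) (slt e) in (nb (var e) d, l).
Definition share (e f : E) : bool :=
  [|| esrc e == esrc f, esrc e == etgt f, etgt e == esrc f | etgt e == etgt f].
Definition conflict_adj : rel E := fun e f => (e != f) && share e f.
Local Notation adj := conflict_adj.

Definition conflict_sat : Prop := exists g : V -> option A,
  forall v d a b, conf v d a b -> ~~ ((g v == a) && (g (nb v d) == b)).

(** Only conflicts touching [v0] may be violated; this is the damage that one contraction can
    repair. *)
Definition conflict_almost_sat : Prop := exists (v0 : V) (g : V -> option A),
  forall v d a b, v != v0 -> nb v d != v0 -> conf v d a b ->
    ~~ ((g v == a) && (g (nb v d) == b)).

Lemma share_sym e f : share e f = share f e.
Proof.
rewrite /share [esrc f == _]eq_sym [esrc f == etgt e]eq_sym [etgt f == _]eq_sym.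
by rewrite [etgt f == etgt e]eq_sym; case: (esrc e == _); case: (etgt e == _);
  case: (esrc e == _); case: (etgt e == _).
Qed.

Lemma conflict_adj_sym : symmetric adj.
Proof. by move=> e f; rewrite /conflict_adj share_sym eq_sym. Qed.

Lemma conflict_adj_irr : irreflexive adj.
Proof. by move=> e; rewrite /conflict_adj eqxx. Qed.

(* Two of three neighbours of [x] meet [x] at the same endpoint. *)
Lemma conflict_adj_no_claw x a b c : adj x a -> adj x b -> adj x c ->
  a != b -> a != c -> b != c -> [|| adj a b, adj a c | adj b c].
Proof.
rewrite /conflict_adj => /andP[_ xa] /andP[_ xb] /andP[_ xc] -> -> -> /=.
move: xa xb xc; rewrite /share.
move=> /or4P[] /eqP<- /or4P[] /eqP<- /or4P[] /eqP<-; rewrite ?eqxx ?orbT //.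
Qed.

Definition loop v s := mk v (inl (inl s)).
Definition star v s a := mk v (inl (inr (s, a))).
Definition cedge v d a b := mk v (inr (d, a, b)).

Lemma src_loop v s : esrc (loop v s) = (v, inl s).
Proof. by rewrite /esrc mk_var mk_slt. Qed.
Lemma tgt_loop v s : etgt (loop v s) = (v, inl s).
Proof. by rewrite /etgt mk_var mk_slt /= nb_self. Qed.
Lemma src_star v s a : esrc (star v s a) = (v, inl s).
Proof. by rewrite /esrc mk_var mk_slt. Qed.
Lemma tgt_star v s a : etgt (star v s a) = (v, inr a).
Proof. by rewrite /etgt mk_var mk_slt /= nb_self. Qed.
Lemma src_cedge v d a b : conf v d a b -> esrc (cedge v d a b) = (v, inr a).
Proof. by move=> c; rewrite /esrc mk_var mk_slt /= c. Qed.
Lemma tgt_cedge v d a b : conf v d a b -> etgt (cedge v d a b) = (nb v d, inr b).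
Proof. by move=> c; rewrite /etgt mk_var mk_slt /= c. Qed.

Lemma star_inj v s a v' s' a' :
  star v s a = star v' s' a' -> [/\ v = v', s = s' & a = a'].
Proof.
move=> H; have := congr1 var H; have := congr1 slt H.
by rewrite !mk_slt !mk_var => -[-> ->] ->.
Qed.

Lemma ends_cases e :
  (exists s, esrc e = (var e, inl s) /\
     (etgt e = (var e, inl s) \/ exists a, etgt e = (var e, inr a))) \/
  (exists d a b, [/\ conf (var e) d a b, esrc e = (var e, inr a) &
     etgt e = (nb (var e) d, inr b)]).
Proof.
rewrite /esrc /etgt; case: (slt e) => [[s|[s a]]|[[d a] b]] /=; rewrite ?nb_self.
- by left; exists s; split=> //; left.
- by left; exists s; split=> //; right; exists a.
case: ifP => c; first by right; exists d, a, b.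
by left; exists a0; rewrite nb_self; split=> //; left.
Qed.

(** A selector is a target only in loops, so an edge meets at most one selector and [esrc] alone
    tells which. *)
Lemma tgt_sel e v s : etgt e = (v, inl s) -> esrc e = (v, inl s).
Proof.
case: (ends_cases e) => [[s' [-> [->|[a ->]]]] //|[d [a [b [_ _ ->]]]] //].
Qed.

Lemma src_sel e v s : esrc e = (v, inl s) ->
  etgt e = (v, inl s) \/ exists a, etgt e = (v, inr a).
Proof.
case: (ends_cases e) => [[s' [-> H]] [<- <-] //|[d [a [b [_ -> _]]]] //].
Qed.

Definition covers (D : {set E}) u := [exists e in D, (esrc e == u) || (etgt e == u)].
Definition dominates (D : {set E}) e := (e \in D) || [exists f in D, adj e f].

Lemma dominatesE D e : dominates D e = covers D (esrc e) || covers D (etgt e).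
Proof.
apply/idP/idP.
- case/orP=> [eD|/exists_inP[f fD /andP[_]]].
    by apply/orP; left; apply/exists_inP; exists e => //; rewrite eqxx.
  by case/or4P=> /eqP H; apply/orP; [left|left|right|right];
    apply/exists_inP; exists f => //; rewrite H eqxx ?orbT.
- rewrite /dominates; case: (boolP (e \in D)) => //= eD.
  case/orP=> /exists_inP[f fD H]; apply/exists_inP; exists f => //;
  (apply/andP; split; first by apply: contraNneq eD => ->);
  by case/orP: H => /eqP H; rewrite /share H eqxx ?orbT.
Qed.

Lemma sel_cover D v s : covers D (v, inl s) ->
  exists2 e, e \in D & esrc e = (v, inl s).
Proof. by case/exists_inP=> e eD /orP[]/eqP H; exists e => //; apply: tgt_sel. Qed.

Definition cost := #|V| * #|A|.
Definition selectors : {set V * label A} := [set (p.1, inl p.2) | p in [set: V * A]].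

Lemma card_selectors : #|selectors| = cost.
Proof. by rewrite card_imset ?cardsT ?card_prod // => -[v s] [v' s'] [-> ->]. Qed.

Lemma cost_le_card : cost <= #|E|.
Proof.
have inj : injective (fun p : V * A => loop p.1 p.2).
  move=> [v s] [v' s'] /= H; have := congr1 esrc H.
  by rewrite !src_loop => -[-> ->].
by rewrite /cost -card_prod -(card_codom inj) max_card.
Qed.

(** * Dominating sets with at most [cost] edges *)

Section TightSet.
Variable D : {set E}.
Hypothesis domD : forall e, dominates D e.
Hypothesis leD : #|D| <= cost.

(** The loop at a selector can only be dominated by an edge meeting that selector. *)
Lemma tight_sel_sub : selectors \subset esrc @: D.
Proof.
apply/subsetP=> u /imsetP[[v s] _ ->] /=.
have := domD (loop v s); rewrite dominatesE src_loop tgt_loop orbb.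
by case/sel_cover=> e eD <-; apply: imset_f.
Qed.

(** At most [cost] edges hit all [cost] selectors, so each selector is hit exactly once. *)
Lemma tight_inj : {in D &, injective esrc}.
Proof.
apply/imset_injP; rewrite eqn_leq leq_imset_card /=.
by apply: leq_trans leD _; rewrite -card_selectors subset_leq_card ?tight_sel_sub.
Qed.

Lemma tight_src e : e \in D -> exists v s, esrc e = (v, inl s).
Proof.
move=> eD; have /eqP E1 : selectors == esrc @: D.
  rewrite eqEcard tight_sel_sub card_selectors.
  exact: leq_trans (leq_imset_card _ _) leD.
have : esrc e \in selectors by rewrite E1 imset_f.
by case/imsetP=> -[v s] _ ->; exists v, s.
Qed.

(** The value covered by the edge of [D] at this selector. If that edge is a loop the answer [None]
    is junk, which is harmless: [pick_value] only bounds the number of covered values from above. *)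
Definition pick_value v s : option A :=
  if [pick e in D | esrc e == (v, inl s)] is Some e then
    (if (etgt e).2 is inr a then a else None) else None.

Lemma cover_value v a : covers D (v, inr a) -> exists2 e, e \in D &
  exists s, [/\ esrc e = (v, inl s), etgt e = (v, inr a) & pick_value v s = a].
Proof.
case/exists_inP=> e eD.
have [v' [s es]] := tight_src eD; rewrite es => /orP[/eqP//|/eqP et].
have vv : v' = v by case: (src_sel es) et => [->|[b ->]] [].
subst v'; exists e => //; exists s; split=> //.
rewrite /pick_value; case: pickP => [f /andP[fD /eqP fs]|/(_ e)]; last by rewrite eD es eqxx.
by rewrite (tight_inj fD eD) ?fs ?es // et.
Qed.

Lemma card_cover_value v (X : {set A}) :
  (forall a, covers D (v, inr a) -> exists2 s, s \in X & pick_value v s = a) ->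
  #|[set a | covers D (v, inr a)]| <= #|X|.
Proof.
move=> H; apply: leq_trans (leq_imset_card (pick_value v) X).
by apply: subset_leq_card; apply/subsetP=> a; rewrite inE => /H[s sX <-]; apply: imset_f.
Qed.

(** Pigeonhole: every selector covers at most one value, and there is one value more than
    selectors. *)
Lemma free_value v : exists a, ~~ covers D (v, inr a).
Proof.
apply/existsP; rewrite -negb_forall; apply/negP=> /forallP H.
have : #|[set a | covers D (v, inr a)]| <= #|[set: A]|.
  by apply: card_cover_value => a /cover_value[e _ [s [_ _ <-]]]; exists s.
rewrite (_ : [set a | _] = setT) ?cardsT ?card_option ?ltnn //.
by apply/setP=> a; rewrite !inE H.
Qed.

Lemma tight_sat : conflict_sat.
Proof.
have /fin_all_exists [g gP] := free_value.
exists g => v d a b c; apply/negP=> /andP[/eqP ga /eqP gb].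
have := domD (cedge v d a b).
by rewrite dominatesE src_cedge // tgt_cedge // -ga -gb !(negbTE (gP _)).
Qed.

(** Their selectors differ, so two adjacent members would share a value; this waste leaves two
    values of one cell uncovered, and all values of a cell conflict. *)
Lemma tight_not_adj u w : u \in D -> w \in D -> ~~ adj u w.
Proof.
move=> uD wD; apply/negP=> /andP[uw sh].
have [v [s us]] := tight_src uD; have [v' [s' ws]] := tight_src wD.
have nsrc : esrc u <> esrc w by move/(tight_inj uD wD)/eqP; rewrite (negbTE uw).
have tt : etgt u = etgt w.
  case/or4P: sh => /eqP //.
  - by rewrite us => /esym/tgt_sel H; case: nsrc; rewrite us H.
  - by rewrite ws => /tgt_sel H; case: nsrc; rewrite ws H.
case: (src_sel us) => [ut|[a ut]].
  by case: nsrc; rewrite us; move: tt; rewrite ut => /esym/tgt_sel ->.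
have vv : v' = v by case: (src_sel ws); rewrite -tt ut => -[] // b [].
subst v'; have ss : s != s' by apply/eqP=> H; case: nsrc; rewrite us ws H.
have pv e s1 b : e \in D -> esrc e = (v, inl s1) -> etgt e = (v, inr b) ->
    pick_value v s1 = b.
  move=> eD es et; rewrite /pick_value; case: pickP => [f /andP[fD /eqP fs]|/(_ e)].
    by rewrite (tight_inj fD eD) ?fs ?es // et.
  by rewrite eD es eqxx.
pose B := [set b | covers D (v, inr b)].
have leB : #|B| <= #|[set: A] :\ s'|.
  apply: card_cover_value => b /cover_value[e eD [s1 [es et pe]]].
  case: (eqVneq s1 s') => [E1|ns]; last by exists s1; rewrite ?inE ?ns.
  subst s1; exists s; first by rewrite !inE ss.
  have E2 : e = w by apply: tight_inj => //; rewrite es ws.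
  by rewrite (pv u s a) //; move: tt; rewrite ut -E2 et => -[].
have : 1 < #|~: B|.
  have := cardsC B; rewrite card_option.
  have := cardsD1 s' [set: A]; rewrite inE /= cardsT; move: leB.
  set x1 := #|B|; set x2 := #|_ :\ _|; set x3 := #|A|; set x4 := #|~: B|; lia.
case/card_gt1P=> x [y [xB yB xy]].
have := domD (cedge v None x y); rewrite dominatesE.
rewrite src_cedge ?tgt_cedge ?nb_self ?conf_self //.
by move: xB yB; rewrite !inE => /negbTE-> /negbTE->.
Qed.
End TightSet.

Lemma semitotal_dominates D : semitotal_dom setT adj D -> forall e, dominates D e.
Proof.
case/and3P=> _ /forall_inP H _ e; rewrite /dominates.
by case: (boolP (e \in D)) => //= eD; apply: H; rewrite !inE eD.
Qed.

(** * Edge sets built from assignments *)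

Definition star_set (g : V -> option A) : {set E} :=
  [set star p.1 p.2 (skip_value (g p.1) p.2) | p in [set: V * A]].

Lemma card_star_set g : #|star_set g| <= cost.
Proof. by apply: leq_trans (leq_imset_card _ _) _; rewrite cardsT card_prod. Qed.

Lemma mem_star_set g v s : star v s (skip_value (g v) s) \in star_set g.
Proof. by apply/imsetP; exists (v, s). Qed.

Lemma skip_value_inj a : injective (@skip_value A a).
Proof.
move=> s s'; rewrite /skip_value; case: eqP => [->|_]; case: eqP => [|_] //.
- by case.
- by case.
Qed.

Lemma skip_value_neq a s : @skip_value A a s != a.
Proof. by rewrite /skip_value; case: (a =P Some s) => [->|/eqP]; rewrite // eq_sym. Qed.

Lemma skip_value_surj a b : a != b -> exists s, @skip_value A a s = b.
Proof.
case: b => [s|] ab.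
  by exists s; rewrite /skip_value (negbTE ab).
by case: a ab => [s _|//]; exists s; rewrite /skip_value eqxx.
Qed.

Lemma star_set_covers_sel g v s : covers (star_set g) (v, inl s).
Proof.
apply/exists_inP; exists (star v s (skip_value (g v) s)); first exact: mem_star_set.
by rewrite src_star eqxx.
Qed.

Lemma star_set_covers_value g v a : g v != a -> covers (star_set g) (v, inr a).
Proof.
case/skip_value_surj=> s sa.
apply/exists_inP; exists (star v s (skip_value (g v) s)); first exact: mem_star_set.
by rewrite tgt_star sa eqxx orbT.
Qed.

Lemma star_set_dominates g e :
  (forall d a b, conf (var e) d a b -> esrc e = (var e, inr a) ->
     etgt e = (nb (var e) d, inr b) -> ~~ ((g (var e) == a) && (g (nb (var e) d) == b))) ->
  dominates (star_set g) e.
Proof.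
move=> H; rewrite dominatesE.
case: (ends_cases e) => [[s [-> _]]|[d [a [b [c es et]]]]].
  by rewrite star_set_covers_sel.
rewrite es et; have := H _ _ _ c es et; rewrite negb_and.
by case/orP=> /star_set_covers_value ->; rewrite ?orbT.
Qed.

Definition other (s : A) := if s == a0 then a1 else a0.
Lemma other_neq s : other s != s.
Proof. by rewrite /other; case: (s =P a0) => [->|/eqP]; rewrite eq_sym // eq_sym. Qed.

(** This gives the semitotal condition: the edge from [s] to the value chosen at [s'] links the
    chosen edges of both selectors. Two distinct selectors [a0] and [a1] are needed here. *)
Lemma star_partner g v s : let s' := other s in
  [/\ star v s' (skip_value (g v) s') != star v s (skip_value (g v) s),
      adj (star v s (skip_value (g v) s)) (star v s (skip_value (g v) s')) &
      adj (star v s (skip_value (g v) s')) (star v s' (skip_value (g v) s'))].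
Proof.
move=> s'; have ns : s' != s := other_neq s; split.
- by apply: contraNneq ns => /star_inj[_ -> _].
- apply/andP; split; last by rewrite /share !src_star eqxx.
  by apply: contraNneq ns => /star_inj[_ _ /skip_value_inj->].
- apply/andP; split; last by rewrite /share !tgt_star eqxx !orbT.
  by apply: contraNneq ns => /star_inj[_ -> _].
Qed.

Lemma sat_gamma : conflict_sat -> gamma_t2 setT adj <= cost.
Proof.
case=> g gP; apply: leq_trans (card_star_set g); apply: gamma_t2_le.
apply/and3P; split; first exact: subsetT.
- apply/forall_inP=> e; rewrite !inE andbT => eD.
  have := @star_set_dominates g e; rewrite /dominates (negbTE eD) /=; apply.
  by move=> d a b /gP.
- apply/forall_inP=> e /imsetP[[v s] _ -> /=].
  have [h1 h2 h3] := star_partner g v s.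
  apply/exists_inP; exists (star v (other s) (skip_value (g v) (other s))).
    exact: mem_star_set.
  rewrite h1 /=; apply/orP; right; apply/exists_inP.
  by exists (star v s (skip_value (g v) (other s))); rewrite ?inE ?h2.
Qed.

Lemma unsat_gamma : ~ conflict_sat -> cost < gamma_t2 setT adj.
Proof.
move=> ns; apply: gamma_t2_geP; first by rewrite ltnS cost_le_card.
move=> D /semitotal_dominates domD; rewrite ltnNge; apply/negP=> leD.
exact/ns/(tight_sat domD leD).
Qed.

(** * Edge contractions *)

Lemma contract_adj_mono (u w x y : E) : x != y -> adj x y -> contract_adj adj u w x y.
Proof.
move=> xy axy; rewrite /contract_adj xy /=.
by case: (x =P u) => [<-|_]; [rewrite axy|case: (y =P u) => [<-|_]; rewrite axy].
Qed.

(** Adding [w], the edge from selector [a0] to the missed value of [v0], to the star set would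
    repair every violated conflict. It meets the chosen edge [u] at the same selector, so
    contracting it into [u] gives its neighbours to [u] without enlarging the set. *)
Lemma almost_sat_contract : conflict_almost_sat ->
  exists u w, adj u w /\ gamma_t2 (setT :\ w) (contract_adj adj u w) <= cost.
Proof.
case=> v0 [g gP].
pose w := star v0 a0 (g v0); pose u := star v0 a0 (skip_value (g v0) a0).
have uw : adj u w.
  apply/andP; split; last by rewrite /share !src_star eqxx.
  by apply: contraNneq (skip_value_neq (g v0) a0) => /star_inj[_ _ ->].
have wS v s s' : star v s (skip_value (g v) s') != w.
  by apply/eqP=> /star_inj[E1 _ H]; have := skip_value_neq (g v) s'; rewrite H E1 eqxx.
exists u, w; split=> //.
apply: leq_trans (card_star_set g); apply: gamma_t2_le; apply/and3P; split.
- by apply/subsetP=> e /imsetP[[v s] _ ->]; rewrite !inE wS.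
- apply/forall_inP=> e; rewrite !inE andbT => /andP[eD ew].
  have eu : e != u by apply: contraNneq eD => ->; apply: mem_star_set.
  case: (boolP (dominates (star_set g) e)) => [|nd].
    rewrite /dominates (negbTE eD) /= => /exists_inP[f fD ef].
    apply/exists_inP; exists f => //; apply: contract_adj_mono => //.
    by case/andP: ef.
  apply/exists_inP; exists u; first exact: mem_star_set.
  rewrite /contract_adj eu (negbTE eu) eqxx /=; apply/orP; right.
  (* An edge that does not meet [w] avoids the missed value [g v0], so a violated conflict touching
     [v0] cannot be its own and the star set already dominates it. *)
  rewrite /conflict_adj ew /=; apply: contraNT nd => nsh.
  apply: star_set_dominates => d a b c es et.
  have sx x : (esrc e == x) || (etgt e == x) -> etgt w == x -> False.
    by move=> h1 /eqP h2; case/orP: h1 => /eqP h1; move: nsh; rewrite /share h1 h2 eqxx ?orbT.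
  case: (eqVneq (var e) v0) => [ev|nv].
    rewrite ev; apply/negP=> /andP[/eqP ga _].
    by apply: (sx (v0, inr a)); rewrite ?es ?ev ?eqxx // tgt_star ga.
  case: (eqVneq (nb (var e) d) v0) => [ev|nv'].
    rewrite ev; apply/negP=> /andP[_ /eqP ga].
    by apply: (sx (v0, inr b)); rewrite ?et ?ev ?eqxx ?orbT // tgt_star ga.
  exact: gP.
- apply/forall_inP=> e /imsetP[[v s] _ -> /=].
  have [h1 h2 h3] := star_partner g v s.
  apply/exists_inP; exists (star v (other s) (skip_value (g v) (other s))).
    exact: mem_star_set.
  rewrite h1 /=; apply/orP; right; apply/exists_inP.
  exists (star v s (skip_value (g v) (other s))); first by rewrite !inE wS.
  by rewrite !contract_adj_mono //; [case/andP: h3|case/andP: h2].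
Qed.

Lemma card_setU1_lt (D : {set E}) z : #|D| < cost -> #|z |: D| <= cost.
Proof. by move=> leD; apply: leq_trans leD; rewrite cardsU1 -add1n leq_add2r leq_b1. Qed.

(* Either way a set of size below [cost] for the contraction yields a tight
   dominating set of the original graph, by adding back one end of the edge. *)
Lemma contract_gamma u w : adj u w ->
  cost <= gamma_t2 (setT :\ w) (contract_adj adj u w).
Proof.
move=> uw; apply: gamma_t2_geP; first by rewrite leqW ?cost_le_card.
move=> D /and3P[/subsetP subD /forall_inP domD _].
rewrite leqNgt; apply/negP=> ltD.
have wD : w \notin D by apply/negP=> /subD; rewrite !inE eqxx.
have nuw : u != w by case/andP: uw.
case: (boolP (u \in D)) => uD.
(* Adding [w] dominates the original graph with at most [cost] edges, two of which are the adjacent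
   [u] and [w]. *)
- have : ~~ adj u w.
    apply: (@tight_not_adj (w |: D)); rewrite ?inE ?eqxx ?uD ?orbT //.
      move=> e; rewrite /dominates; case: (boolP (e \in w |: D)) => //=.
      rewrite !inE negb_or => /andP[ew eD].
      have /domD /exists_inP[f fD] : e \in (setT :\ w) :\: D by rewrite !inE eD ew.
      rewrite /contract_adj => /andP[ef].
      have -> : e == u = false by apply: contraNF eD => /eqP->.
      case: (f =P u) => [fu|_] H; last by apply/exists_inP; exists f; rewrite ?inE ?fD ?orbT.
      case/orP: H => H; apply/exists_inP; [exists u|exists w] => //;
        by rewrite !inE ?uD ?eqxx ?orbT.
    exact: card_setU1_lt.
  by rewrite uw.
- have domO e : e != u -> e != w -> dominates D e.
    move=> eu ew; rewrite /dominates; case: (boolP (e \in D)) => //= eD.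
    have /domD /exists_inP[f fD] : e \in (setT :\ w) :\: D by rewrite !inE eD ew.
    rewrite /contract_adj (negbTE eu) => /andP[_].
    have /negbTE-> : f != u by apply: contraNneq uD => <-.
    by move=> ef; apply/exists_inP; exists f.
  (* The neighbour in [D] of the merged vertex was a neighbour of [u] or of [w], so at most the
     other one is undominated. *)
  have [z zP] : exists z, [/\ z \notin D & forall e, e != z -> dominates D e].
    have /domD /exists_inP[f fD] : u \in (setT :\ w) :\: D by rewrite !inE uD nuw.
    rewrite /contract_adj eqxx => /andP[_ /orP[] H].
      exists w; split=> // e ew; case: (eqVneq e u) => [->|]; last by move=> eu; apply: domO.
      by rewrite /dominates; apply/orP; right; apply/exists_inP; exists f.
    exists u; split=> // e eu; case: (eqVneq e w) => [->|]; last by move=> ew; apply: domO.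
    by rewrite /dominates; apply/orP; right; apply/exists_inP; exists f.
  case: zP => zD zP; pose D' := z |: D.
  have subDD' : D \subset D' by apply: subsetUr.
  have leD' : #|D'| <= cost by apply: card_setU1_lt.
  have domD' e : dominates D' e.
    rewrite /dominates !inE; case: (eqVneq e z) => //= /zP /orP[->//|/exists_inP[f fD ef]].
    by apply/orP; right; apply/exists_inP; exists f => //; apply: (subsetP subDD').
  have zD' : z \in D' by rewrite setU11.
  have [v [s zs]] := tight_src domD' leD' zD'.
  have [a na] := free_value domD' leD' v.
  (* The edge from the selector of [z] to a free value must be dominated without [z]; but in [D']
     only [z] meets that selector, and nothing meets that value. *)
  case: (eqVneq (star v s a) z) => [E1|/zP].
    by case/negP: na; apply/exists_inP; exists z => //; rewrite -E1 tgt_star eqxx orbT.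
  rewrite dominatesE src_star tgt_star => /orP[/sel_cover[f fD fs]|].
    have : f = z by apply: (tight_inj domD' leD') => //; [apply: (subsetP subDD')|rewrite fs zs].
    by move=> E1; rewrite -E1 fD in zD.
  case/exists_inP=> f fD H; case/negP: na; apply/exists_inP; exists f => //.
  exact: (subsetP subDD').
Qed.

Theorem conflict_graph_ct : conflict_almost_sat ->
  (ct_gt2_le1 setT adj <-> ~ conflict_sat).
Proof.
move=> asat; split.
- case/exists_inP=> u _ /exists_inP[w _ /andP[uw lt]] sat.
  have := contract_gamma uw; have := sat_gamma sat; lia.
- move=> ns; have [u [w [uw le]]] := almost_sat_contract asat.
  apply/exists_inP; exists u; rewrite ?inE //.
  apply/exists_inP; exists w; rewrite ?inE // uw /=.
  exact: leq_ltn_trans le (unsat_gamma ns).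
Qed.

(** * Connectedness *)

Hypothesis conf_none : forall v d b, nb v d != v -> conf v d None b.

Lemma conflict_adj_var_connect v : forall k k', connect adj (mk v k) (mk v k').
Proof.
have sym : connect_sym adj by apply: sym_connect_sym; apply: conflict_adj_sym.
have step e f : share e f -> connect adj e f.
  move=> sh; case: (eqVneq e f) => [->//|ef]; apply: connect1.
  by rewrite /conflict_adj ef.
have meet e f g : esrc e = g \/ etgt e = g -> esrc f = g \/ etgt f = g -> connect adj e f.
  by case=> H1 [] H2; apply: step; rewrite /share H1 H2 eqxx ?orbT.
have toq k : exists s, connect adj (mk v k) (loop v s).
  case: (ends_cases (mk v k)) => [[s [es _]]|[d [a [b [_ es _]]]]]; rewrite mk_var in es.
    by exists s; apply: (meet _ _ (v, inl s)); [left|left; rewrite src_loop].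
  exists a0; apply: (connect_trans (y := star v a0 a)).
    by apply: (meet _ _ (v, inr a)); [left|right; rewrite tgt_star].
  by apply: (meet _ _ (v, inl a0)); [left; rewrite src_star|left; rewrite src_loop].
have qq s s' : connect adj (loop v s) (loop v s').
  apply: (connect_trans (y := star v s None)).
    by apply: (meet _ _ (v, inl s)); left; rewrite ?src_star ?src_loop.
  apply: (connect_trans (y := star v s' None)).
    by apply: (meet _ _ (v, inr None)); right; rewrite tgt_star.
  by apply: (meet _ _ (v, inl s')); left; rewrite ?src_star ?src_loop.
move=> k k'; have [s h] := toq k; have [s' h'] := toq k'.
by apply: connect_trans h (connect_trans (qq s s') _); rewrite sym.
Qed.

(** The bridge between the two cells is the conflict edge joining their [None] values. *)
Lemma conflict_adj_nb_connect v d k k' : connect adj (mk v k) (mk (nb v d) k').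
Proof.
case: (eqVneq (nb v d) v) => [->|nv]; first exact: conflict_adj_var_connect.
have c : conf v d None None by apply: conf_none.
apply: connect_trans (conflict_adj_var_connect v k (inr (d, None, None))) _.
apply: connect_trans (conflict_adj_var_connect (nb v d) (inl (inr (a0, None))) k').
apply: connect1; apply/andP; split.
  by apply: contraNneq nv => /(congr1 var); rewrite !mk_var => <-.
by rewrite /share (tgt_cedge c) tgt_star eqxx !orbT.
Qed.
End ConflictGraph.

(** * Pointer machines on a single tape *)

Definition polyb (f : nat -> nat) := exists k, forall n, f n <= k * n.+1 ^ k.

Section Tape.
Variable M : TM.

Definition tape_at (c : config M) (i : nat) : tm_sym M :=
  let: (_, l, h, r) := c in nth (@tm_blank M) (rev l ++ h :: r) i.
Definition head_pos (c : config M) : nat := let: (_, l, _, _) := c in size l.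

(** Squares are numbered from the left end of the stored tape, and configurations are identified up
    to trailing blanks. *)
Definition cfg (c : config M) q p (f : nat -> tm_sym M) : Prop :=
  [/\ tm_state_of c = q, head_pos c = p & forall i, tape_at c i = f i].

Definition move_pos (p : nat) (m : move) : nat :=
  match m with MoveL => p.-1 | MoveR => p.+1 | Stay => p end.

Definition fupd (f : nat -> tm_sym M) p s i := if i == p then s else f i.

Lemma nth_cat_upd (T : Type) (b : T) u h s v i :
  nth b (u ++ s :: v) i = if i == size u then s else nth b (u ++ h :: v) i.
Proof.
rewrite !nth_cat; case: ltngtP => // [lt|->]; last by rewrite subnn.
by have -> : i - size u = (i - (size u).+1).+1 by lia.
Qed.

Lemma cfg_step c q p f q' s m : cfg c q p f -> ~~ @tm_halt M q ->
  @tm_delta M q (f p) = (q', s, m) -> (m = MoveL -> 0 < p) ->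
  cfg (tm_step c) q' (move_pos p m) (fupd f p s).
Proof.
case: c => [[[q1 l] h] r] [/= -> <- Ef] nh Ed mL.
have fh : f (size l) = h by rewrite -Ef nth_cat size_rev ltnn subnn.
rewrite /tm_step (negbTE nh) -fh Ed /fupd; case: m mL {Ed} => mL.
- case: l fh Ef mL => [_ _ /(_ erefl)//|a l fh Ef _]; split=> //= i.
  rewrite -Ef rev_cons -cat_rcons.
  by rewrite (@nth_cat_upd _ _ _ h) size_rcons size_rev.
- have E1 a : rev (s :: l) ++ a = rev l ++ s :: a by rewrite rev_cons cat_rcons.
  case: r Ef => [|a r] Ef; split=> //= i; rewrite -Ef E1.
    rewrite -cat1s catA nth_cat size_cat /= size_rev.
    rewrite (@nth_cat_upd _ _ _ h) size_rev.
    case: ltnP => // le; have -> : (i == size l) = false by lia.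
    have -> : nth (tm_blank M) (rev l ++ [:: h]) i = tm_blank M.
      by rewrite nth_default // size_cat size_rev.
    by case: (i - _) => // -[].
  by rewrite (@nth_cat_upd _ _ _ h) size_rev.
- split=> //= i; rewrite -Ef.
  by rewrite (@nth_cat_upd _ _ _ h) size_rev.
Qed.

Lemma cfg_ext c q p f g : f =1 g -> cfg c q p f -> cfg c q p g.
Proof. by move=> fg [h1 h2 h3]; split=> // i; rewrite h3. Qed.

Definition reach q p f n q' p' f' :=
  forall c, cfg c q p f -> cfg (iter n (@tm_step M) c) q' p' f'.

Lemma reach_trans q2 p2 f2 n1 n2 q1 p1 f1 q3 p3 f3 :
  reach q1 p1 f1 n1 q2 p2 f2 -> reach q2 p2 f2 n2 q3 p3 f3 ->
  reach q1 p1 f1 (n1 + n2) q3 p3 f3.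
Proof. by move=> h1 h2 c /h1 /h2; rewrite -iterD addnC. Qed.

Lemma reach_step q p f q' s m : ~~ @tm_halt M q ->
  @tm_delta M q (f p) = (q', s, m) -> (m = MoveL -> 0 < p) ->
  reach q p f 1 q' (move_pos p m) (fupd f p s).
Proof. by move=> nh Ed mL c hc /=; apply: cfg_step hc _ _ _. Qed.

Lemma reach_still q p f q' m : ~~ @tm_halt M q ->
  @tm_delta M q (f p) = (q', f p, m) -> (m = MoveL -> 0 < p) ->
  reach q p f 1 q' (move_pos p m) f.
Proof.
move=> nh Ed mL c /(reach_step nh Ed mL); apply: cfg_ext => i.
by rewrite /fupd; case: eqP => // ->.
Qed.

Lemma reach_right q f p n : ~~ @tm_halt M q ->
  (forall i, p <= i < p + n -> @tm_delta M q (f i) = (q, f i, MoveR)) ->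
  reach q p f n q (p + n) f.
Proof.
move=> nh; elim: n p => [|n IH] p H; first by rewrite addn0 => c.
rewrite -add1n; apply: reach_trans (@reach_still _ p f q MoveR nh _ _) _ => //.
  by apply: H; lia.
by rewrite /= -addSnnS; apply: IH => i ?; apply: H; lia.
Qed.

Lemma reach_left q f n : ~~ @tm_halt M q ->
  (forall i, 0 < i <= n -> @tm_delta M q (f i) = (q, f i, MoveL)) ->
  reach q n f n q 0 f.
Proof.
move=> nh; elim: n => [|n IH] H; first by move=> c.
rewrite -{2}[n.+1]add1n; apply: reach_trans (@reach_still _ n.+1 f q MoveL nh _ _) _ => //.
  by apply: H; lia.
by apply: IH => i ?; apply: H; lia.
Qed.

Lemma read_bits_nth (o : seq bool) w :
  @tm_blank M != @tm_b0 M -> @tm_blank M != @tm_b1 M -> @tm_b0 M != @tm_b1 M ->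
  (forall i, i < size o -> nth (@tm_blank M) w i = bit_sym M (nth false o i)) ->
  nth (@tm_blank M) w (size o) = @tm_blank M -> read_bits w = o.
Proof.
move=> n0 n1 n01; elim: o w => [|b o IH] [|a w] //= H He.
- by rewrite He (negbTE n0) (negbTE n1).
- by have := H 0 isT; rewrite /= /bit_sym => E; move: n0 n1; rewrite E; case: b {H E}; rewrite eqxx.
- have /= -> := H 0 isT; rewrite /bit_sym; case: b H => H; rewrite ?eqxx ?(negbTE n01);
  by rewrite (IH w) // => i /(H i.+1).
Qed.
End Tape.

(** * Register programs with comparisons, input access and output *)

Inductive test (R : Type) := TLt of R & R | TEq of R & R | TBit of R | TIn of R.
Inductive instr (R Q : Type) :=
  IInc of R & Q | IZero of R & Q | IOut of bool & Q | ITest of test R & Q & Q.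
Arguments IInc {R Q}. Arguments IZero {R Q}. Arguments IOut {R Q}. Arguments ITest {R Q}.

Record pstate (R : Type) := PState { regs : R -> nat; out : seq bool }.

Record prog (R : Type) := Prog {
  pctl : finType;
  pstart : option pctl;
  pcode : pctl -> instr R (option pctl) }.

Section PointerMachine.
Variable R : finType.
Implicit Type s : pstate R.

Definition rupd (e : R -> nat) (r : R) (v : nat) (i : R) := if i == r then v else e i.

Definition teval (x : seq bool) s (t : test R) : bool :=
  match t with
  | TLt i j => regs s i < regs s j
  | TEq i j => regs s i == regs s j
  | TBit i => nth false x (regs s i)
  | TIn i => regs s i < size x
  end.

Definition iexec (Q : Type) x (i : instr R Q) s : Q * pstate R :=
  match i with
  | IInc r q => (q, PState (rupd (regs s) r (regs s r).+1) (out s))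
  | IZero r q => (q, PState (rupd (regs s) r 0) (out s))
  | IOut b q => (q, PState (regs s) (rcons (out s) b))
  | ITest t q1 q2 => (if teval x s t then q1 else q2, s)
  end.

Inductive runs (Q : Type) (code : Q -> instr R (option Q)) x :
  option Q -> pstate R -> nat -> option Q -> pstate R -> Prop :=
| runs0 o s : runs code x o s 0 o s
| runsS q s c o s' :
    runs code x (iexec x (code q) s).1 (iexec x (code q) s).2 c o s' ->
    runs code x (Some q) s c.+1 o s'.

(* A tape cell: left-end flag, input bit, output bit, and for each register
   whether its value is the index of this cell. *)
Definition cell : finType := (bool * option bool * option bool * {ffun R -> bool})%type.
Definition clft (c : cell) := c.1.1.1.
Definition cinp (c : cell) := c.1.1.2.
Definition cout (c : cell) := c.1.2.
Definition cmark (c : cell) (r : R) := c.2 r.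
Definition setmark (c : cell) r b : cell :=
  (clft c, cinp c, cout c, [ffun i => if i == r then b else cmark c i]).
Definition setout (c : cell) b : cell := (clft c, cinp c, Some b, c.2).

Definition cell_at x s (i : nat) : cell :=
  (i == 0, nth None (map Some x) i, nth None (map Some (out s)) i,
   [ffun r => regs s r == i]).

(** A scan from the left can decide a test at the first marked cell it meets, since the smaller
    register is marked first. *)
Definition tstop (t : test R) (c : cell) : bool :=
  match t with
  | TLt i j | TEq i j => cmark c i || cmark c j
  | TBit i | TIn i => cmark c i
  end.

Definition tres (t : test R) (c : cell) : bool :=
  match t with
  | TLt i j => ~~ cmark c j
  | TEq i j => cmark c i && cmark c j
  | TBit i => cinp c == Some true
  | TIn i => cinp c != None
  end.

Definition tpos s (t : test R) : nat :=
  match t with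
  | TLt i j | TEq i j => minn (regs s i) (regs s j)
  | TBit i | TIn i => regs s i
  end.

Lemma nth_map_Some (y : seq bool) i :
  nth None (map Some y) i = if i < size y then Some (nth false y i) else None.
Proof.
by case: ltnP => le; [rewrite (nth_map false)|rewrite nth_default // size_map].
Qed.

Lemma tstop_at x s t : tstop t (cell_at x s (tpos s t)).
Proof. by case: t => [i j|i j|i|i] /=; rewrite /cmark !ffunE /=; lia. Qed.

Lemma tstop_before x s t i : i < tpos s t -> ~~ tstop t (cell_at x s i).
Proof. by case: t => [a b|a b|a|a] /=; rewrite /cmark !ffunE /=; lia. Qed.

Lemma tres_at x s t : tres t (cell_at x s (tpos s t)) = teval x s t.
Proof.
case: t => [i j|i j|i|i] /=; rewrite /cmark /cinp ?ffunE /= ?nth_map_Some; try lia.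
  by case: ltnP => lt; [case: nth|rewrite nth_default].
by case: ltnP.
Qed.

(** * Simulation of a register program by a one-tape machine *)

Section Compile.
Variable P : prog R.
Local Notation Q := (pctl P).

Definition msym : finType := (bool + cell)%type.
Definition mblank : msym := inr (false, None, None, [ffun=> false]).
(** Raw bits decode to unmarked cells, and blanks to empty ones, so the machine needs no preliminary
    pass over its input. *)
Definition dec (s : msym) : cell :=
  match s with inl b => (false, Some b, None, [ffun=> false]) | inr c => c end.

Definition mstate : finType :=
  ((Q + R * option Q * bool) + (option Q + bool * bool))%type.
Definition Seek q : mstate := inl (inl q).
Definition Mark r o : mstate := inl (inr (r, o, true)).
Definition RetZero r o : mstate := inl (inr (r, o, false)).
Definition Ret o : mstate := inr (inl o).
Definition Start : mstate := inr (inr (false, false)).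
Definition Fin : mstate := inr (inr (false, true)).
Definition Back : mstate := inr (inr (true, false)).
Definition Halt : mstate := inr (inr (true, true)).
Definition after (o : option Q) := if o is Some q then Seek q else Fin.

(** Each instruction is one sweep from the left end to the cell concerned and back. Output bits
    share squares with input and marks; they become raw bits only in the last phases [Fin] and
    [Back]. *)
Definition mdelta (st : mstate) (h : msym) : mstate * msym * move :=
  let c := dec h in
  match st with
  | inl (inl q) =>
    match pcode q with
    | IInc r o => if cmark c r then (Mark r o, inr (setmark c r false), MoveR)
                  else (st, h, MoveR)
    | IZero r o => if cmark c r then (RetZero r o, inr (setmark c r false), Stay)
                   else (st, h, MoveR)
    | IOut b o => if cout c == None then (Ret o, inr (setout c b), Stay)
                  else (st, h, MoveR)
    | ITest t o1 o2 => if tstop t c then (Ret (if tres t c then o1 else o2), h, Stay)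
                       else (st, h, MoveR)
    end
  | inl (inr (r, o, true)) => (Ret o, inr (setmark c r true), Stay)
  | inl (inr (r, o, false)) =>
    if clft c then (Ret o, inr (setmark c r true), Stay) else (st, h, MoveL)
  | inr (inl o) => if clft c then (after o, h, Stay) else (st, h, MoveL)
  | inr (inr (false, false)) =>
    (Ret (pstart P), inr (true, cinp c, None, [ffun=> true]), Stay)
  | inr (inr (false, true)) =>
    if cout c == None then
      if clft c then (Halt, mblank, Stay) else (Back, mblank, MoveL)
    else (st, h, MoveR)
  | inr (inr (true, false)) =>
    let s : msym := inl (odflt false (cout c)) in
    if clft c then (Halt, s, Stay) else (Back, s, MoveL)
  | inr (inr (true, true)) => (st, h, Stay)
  end.

Definition machine : TM :=
  @MkTM mstate msym mblank (inl false) (inl true) Start (pred1 Halt) mdelta.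

Variable x : seq bool.
Implicit Type f : nat -> msym.
Definition tape_rel s f := forall i, dec (f i) = cell_at x s i.
Local Notation reach := (@reach machine).

Lemma reach_ret o s f p : tape_rel s f -> reach (Ret o) p f p.+1 (after o) 0 f.
Proof.
move=> rel; rewrite -[p.+1]addn1; apply: (@reach_trans machine (Ret o) 0 f).
  by apply: reach_left => // i; rewrite /= rel /clft /= => ?; have -> : (i == 0) = false by lia.
by apply: (@reach_still machine (Ret o) 0 f (after o) Stay) => //=; rewrite rel.
Qed.

Lemma reach_seek q f p : (forall i, i < p -> mdelta (Seek q) (f i) = (Seek q, f i, MoveR)) ->
  reach (Seek q) 0 f p (Seek q) p f.
Proof. by move=> H; apply: (@reach_right machine) => // i; rewrite add0n => /andP[_ /H]. Qed.

Lemma sim_step s f q b : tape_rel s f ->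
  (forall r, regs s r <= b) -> size (out s) <= b ->
  let: (o, s') := iexec x (pcode q) s in
  exists n f', [/\ n <= 2 * b + 6, tape_rel s' f' & reach (Seek q) 0 f n (after o) 0 f'].
Proof.
move=> rel rb ob; case Eq: (pcode q) => [r o|r o|c o|t o1 o2] /=.
- set p := regs s r; have pb : p <= b by apply: rb.
  pose f1 := fupd (M := machine) f p (inr (setmark (dec (f p)) r false)).
  pose f2 := fupd (M := machine) f1 p.+1 (inr (setmark (dec (f1 p.+1)) r true)).
  have rel2 : tape_rel (PState (rupd (regs s) r p.+1) (out s)) f2.
    move=> i; rewrite /f2 /f1 /fupd /=.
    have -> : (p.+1 == p) = false by lia.
    case: (i =P p.+1) => [->|/eqP n1].
      rewrite /= rel /setmark /cell_at /=; congr (_, _, _, _).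
      by apply/ffunP=> j; rewrite /cmark !ffunE /rupd /=; case: ifP => // _; rewrite eqxx.
    case: (i =P p) => [->|/eqP n2].
      rewrite /= rel /setmark /cell_at /=; congr (_, _, _, _).
      apply/ffunP=> j; rewrite /cmark !ffunE /rupd /=; case: ifP => // _.
      by apply/esym/negbTE; lia.
    rewrite rel /cell_at /=; congr (_, _, _, _).
    apply/ffunP=> j; rewrite !ffunE /rupd /=; case: (j =P r) => [->|//].
    by rewrite -/p; lia.
  exists (p + (1 + (1 + p.+2))), f2; split=> //; first by lia.
  apply: (@reach_trans machine (Seek q) p f).
    apply: reach_seek => i lt; rewrite /= Eq rel /cmark ffunE /=.
    by have -> : (regs s r == i) = false by lia.
  apply: (@reach_trans machine (Mark r o) p.+1 f1).
    apply: (@reach_step machine _ p f _ _ MoveR) => //=.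
    by rewrite Eq rel /cmark ffunE eqxx.
  apply: (@reach_trans machine (Ret o) p.+1 f2); last exact: reach_ret rel2.
  exact: (@reach_step machine _ p.+1 f1 _ _ Stay).
- set p := regs s r; have pb : p <= b by apply: rb.
  pose f1 := fupd (M := machine) f p (inr (setmark (dec (f p)) r false)).
  pose f2 := fupd (M := machine) f1 0 (inr (setmark (dec (f1 0)) r true)).
  have lft i : clft (dec (f1 i)) = (i == 0).
    by rewrite /f1 /fupd; case: (i =P p) => [->|_] /=; rewrite rel.
  have rel2 : tape_rel (PState (rupd (regs s) r 0) (out s)) f2.
    move=> i; rewrite /f2 /fupd /=.
    case: (i =P 0) => [->|/eqP n1].
      rewrite /f1 /fupd; case: (0 =P p) => [<-|/eqP n2]; rewrite /= ?rel /setmark /cell_at /=;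
      by congr (_, _, _, _); apply/ffunP=> j; rewrite /cmark !ffunE /rupd /=;
        case: ifP => // e; rewrite ?ffunE ?e.
    rewrite /f1 /fupd; case: (i =P p) => [Ei|/eqP n2].
      rewrite Ei /= rel /setmark /cell_at /=; congr (_, _, _, _).
      apply/ffunP=> j; rewrite /cmark !ffunE /rupd /=; case: ifP => // _.
      by apply/esym/negbTE; lia.
    rewrite rel /cell_at /=; congr (_, _, _, _).
    apply/ffunP=> j; rewrite !ffunE /rupd /=; case: (j =P r) => [->|//].
    by rewrite -/p; lia.
  exists (p + (1 + (p + (1 + 1)))), f2; split=> //; first by lia.
  apply: (@reach_trans machine (Seek q) p f).
    apply: reach_seek => i lt; rewrite /= Eq rel /cmark ffunE /=.
    by have -> : (regs s r == i) = false by lia.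
  apply: (@reach_trans machine (RetZero r o) p f1).
    apply: (@reach_step machine _ p f _ _ Stay) => //=.
    by rewrite Eq rel /cmark ffunE eqxx.
  apply: (@reach_trans machine (RetZero r o) 0 f1).
    apply: (@reach_left machine) => // i ?; rewrite /= lft.
    by have -> : (i == 0) = false by lia.
  apply: (@reach_trans machine (Ret o) 0 f2); last exact: reach_ret rel2.
  by apply: (@reach_step machine _ 0 f1 _ _ Stay) => //=; rewrite lft.
- set p := size (out s).
  pose f1 := fupd (M := machine) f p (inr (setout (dec (f p)) c)).
  have rel1 : tape_rel (PState (regs s) (rcons (out s) c)) f1.
    move=> i; rewrite /f1 /fupd /=; case: (i =P p) => [->|/eqP n1].
      rewrite /= rel /setout /cell_at /=; congr (_, _, _, _).
      by rewrite map_rcons nth_rcons size_map ltnn eqxx.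
    rewrite rel /cell_at /=; congr (_, _, _, _).
    rewrite map_rcons nth_rcons size_map -/p (negbTE n1).
    by case: ltnP => // le; rewrite nth_default // size_map.
  exists (p + (1 + p.+1)), f1; split=> //; first by lia.
  apply: (@reach_trans machine (Seek q) p f).
    by apply: reach_seek => i lt; rewrite /= Eq rel /cout /= nth_map_Some lt.
  apply: (@reach_trans machine (Ret o) p f1); last exact: reach_ret rel1.
  apply: (@reach_step machine _ p f _ _ Stay) => //=.
  by rewrite Eq rel /cout /= nth_map_Some ltnn.
- set p := tpos s t; have pb : p <= b.
    by rewrite /p; case: (t) => [i j|i j|i|i] //=; rewrite geq_min rb.
  exists (p + (1 + p.+1)), f; split=> //; first by lia.
  apply: (@reach_trans machine (Seek q) p f).
    by apply: reach_seek => i lt; rewrite /= Eq rel (negbTE (tstop_before _ lt)).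
  apply: (@reach_trans machine (Ret (if teval x s t then o1 else o2)) p f).
    by apply: (@reach_still machine _ p f _ Stay) => //=; rewrite Eq rel tstop_at tres_at.
  exact: reach_ret rel.
Qed.

Lemma iexec_bound Q' (i : instr R Q') s b :
  (forall r, regs s r <= b) -> size (out s) <= b ->
  (forall r, regs (iexec x i s).2 r <= b.+1) /\ size (out (iexec x i s).2) <= b.+1.
Proof.
move=> rb ob; case: i => [r o|r o|c o|t o1 o2] /=.
- split=> [j|]; last exact: leqW.
  by rewrite /rupd; case: ifP => _; [rewrite ltnS|apply: leqW].
- split=> [j|]; last exact: leqW.
  by rewrite /rupd; case: ifP => _ //; apply: leqW.
- by split=> [j|]; rewrite ?size_rcons ?ltnS //; apply: leqW.
- by split=> [j|]; apply: leqW.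
Qed.

(** An instruction raises a register or the output length by at most one, so every sweep stays
    within [b + c] squares, up to a constant. *)
Lemma sim_runs o s c o' s' : runs (@pcode _ P) x o s c o' s' -> forall f b,
  tape_rel s f -> (forall r, regs s r <= b) -> size (out s) <= b ->
  exists n f', [/\ n <= c * (2 * (b + c) + 6), tape_rel s' f',
    reach (after o) 0 f n (after o') 0 f' & size (out s') <= b + c].
Proof.
elim=> {o s c o' s'} [o s|q s c o s' _ IH] f b rel rb ob.
  by exists 0, f; split=> //; rewrite addn0.
have := sim_step q rel rb ob; have := iexec_bound (pcode q) rb ob.
case: (iexec _ _ _) IH => o1 s1 /= IH [rb1 ob1] [n1 [f1 [n1b rel1 h1]]].
have [n2 [f2 [n2b rel2 h2 ob2]]] := IH _ _ rel1 rb1 ob1.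
exists (n1 + n2), f2; split=> //; first by nia.
  exact: reach_trans h1 h2.
by lia.
Qed.

Lemma sim_back f n o : 
  (forall i, i <= n -> clft (dec (f i)) = (i == 0)) ->
  (forall i, i <= n -> cout (dec (f i)) = Some (nth false o i)) ->
  exists f', [/\ reach Back n f n.+1 Halt 0 f',
    forall i, i <= n -> f' i = inl (nth false o i) & forall i, n < i -> f' i = f i].
Proof.
elim: n f => [|n IH] f lf co.
  exists (fupd (M := machine) f 0 (inl (nth false o 0))); split.
  - by apply: (@reach_step machine _ 0 f _ _ Stay) => //=; rewrite lf // co.
  - by case.
  - by case.
pose f1 := fupd (M := machine) f n.+1 (inl (nth false o n.+1)).
have f1E i : i <= n -> f1 i = f i.
  by move=> le; rewrite /f1 /fupd; have -> : (i == n.+1) = false by lia.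
have lf1 i : i <= n -> clft (dec (f1 i)) = (i == 0) by move=> le; rewrite f1E // lf // leqW.
have co1 i : i <= n -> cout (dec (f1 i)) = Some (nth false o i).
  by move=> le; rewrite f1E // co // leqW.
have [f' [h1 h2 h3]] := IH f1 lf1 co1.
exists f'; split.
- rewrite -[n.+2]add1n; apply: (@reach_trans machine Back n f1); last exact: h1.
  by apply: (@reach_step machine _ n.+1 f _ _ MoveL) => //=; rewrite lf // co.
- move=> i; rewrite leq_eqVlt ltnS => /orP[/eqP->|]; last exact: h2.
  by rewrite h3 // /f1 /fupd eqxx.
- move=> i lt; rewrite h3; last by lia.
  by rewrite /f1 /fupd; have -> : (i == n.+1) = false by lia.
Qed.

(** The square after the last output bit may still hold a raw input bit; it is blanked so that
    [read_bits] stops there. *)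
Lemma sim_final s f : tape_rel s f -> exists n f',
  [/\ n <= 2 * size (out s) + 2, reach Fin 0 f n Halt 0 f',
      forall i, i < size (out s) -> f' i = inl (nth false (out s) i) &
      f' (size (out s)) = mblank].
Proof.
move=> rel; have co i : cout (dec (f i)) =
    if i < size (out s) then Some (nth false (out s) i) else None.
  by rewrite rel /cout /= nth_map_Some.
have lf i : clft (dec (f i)) = (i == 0) by rewrite rel.
case Eo: (size (out s)) => [|k].
  exists 1, (fupd (M := machine) f 0 mblank); split=> //.
  by apply: (@reach_step machine _ 0 f _ _ Stay) => //=; rewrite co Eo lf.
pose f1 := fupd (M := machine) f k.+1 mblank.
have f1E i : i <= k -> f1 i = f i.
  by move=> le; rewrite /f1 /fupd; have -> : (i == k.+1) = false by lia.
have lf1 i : i <= k -> clft (dec (f1 i)) = (i == 0) by move=> le; rewrite f1E.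
have co1 i : i <= k -> cout (dec (f1 i)) = Some (nth false (out s) i).
  by move=> le; rewrite f1E // co Eo ltnS le.
have [f' [h1 h2 h3]] := sim_back lf1 co1.
exists (k.+1 + (1 + k.+1)), f'; split=> //; first by lia.
  apply: (@reach_trans machine Fin k.+1 f).
    apply: (@reach_right machine) => // i; rewrite add0n => /andP[_ lt].
    by rewrite /= co Eo lt.
  apply: (@reach_trans machine Back k f1); last exact: h1.
  by apply: (@reach_step machine _ k.+1 f _ _ MoveL) => //=; rewrite co Eo ltnn lf.
by rewrite h3 // /f1 /fupd eqxx.
Qed.

Definition pinit : pstate R := PState (fun=> 0) [::].

Lemma machine_correct c s : runs (@pcode _ P) x (pstart P) pinit c None s ->
  exists n, [/\ n <= c * (2 * c + 6) + 2 * c + 4,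
    @tm_halt machine (tm_state_of (tm_run n (tm_init machine x))) &
    tm_output (tm_run n (tm_init machine x)) = out s].
Proof.
move=> hr; pose f0 i : msym := nth mblank (map (bit_sym machine) x) i.
have h0 : cfg (tm_init machine x) Start 0 f0.
  by rewrite /tm_init /f0; case: (map _ x) => [|a w]; split=> //= -[|[|i]].
(* The first step flags the left end and puts all marks on square 0, as every register starts at
   0. *)
pose f1 := fupd (M := machine) f0 0 (inr (true, cinp (dec (f0 0)), None, [ffun=> true])).
have f0E i : dec (f0 i) = (false, nth None (map Some x) i, None, [ffun=> false]).
  rewrite /f0 nth_map_Some; case: ltnP => lt.
    by rewrite (nth_map false) // /bit_sym; case: nth.
  by rewrite nth_default // size_map.
have rel1 : tape_rel pinit f1.
  move=> [|i]; rewrite /f1 /fupd /= f0E /cell_at /cinp /= ?nth_nil.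
    by congr (_, _, _, _); apply/ffunP=> r; rewrite !ffunE.
  by congr (_, _, _, _); apply/ffunP=> r; rewrite !ffunE.
have [n1 [f2 [n1b rel2 h1 ob]]] := sim_runs hr rel1 (b := 0) (fun=> isT) isT.
have [n2 [f3 [n2b h2 f3o f3b]]] := sim_final rel2.
exists (1 + (1 + (n1 + n2))).
have : cfg (tm_run (1 + (1 + (n1 + n2))) (tm_init machine x)) Halt 0 f3.
  apply: (@reach_trans machine (Ret (pstart P)) 0 f1) h0.
    exact: (@reach_step machine _ 0 f0 _ _ Stay).
  apply: (@reach_trans machine (after (pstart P)) 0 f1); first exact: reach_ret rel1.
  exact: reach_trans h1 h2.
case: (tm_run _ _) => [[[q l] h] r] [/= -> /size0nil -> Ef]; split=> //; first by lia.
apply: (@read_bits_nth machine _ (h :: r)) => // [i lt|].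
  by rewrite -[_ :: r]/(rev [::] ++ h :: r) Ef f3o // /bit_sym; case: nth.
by rewrite -[_ :: r]/(rev [::] ++ h :: r) Ef f3b.
Qed.
End Compile.
End PointerMachine.

(** * Closure properties of polynomial bounds *)

Lemma polyb_le f g : (forall n, f n <= g n) -> polyb g -> polyb f.
Proof. by move=> fg [k H]; exists k => n; apply: leq_trans (fg n) (H n). Qed.

Lemma polyb_const c : polyb (fun=> c).
Proof. by exists c => n; rewrite leq_pmulr // expn_gt0. Qed.

Lemma polyb_id : polyb id.
Proof. by exists 1 => n; rewrite mul1n expn1. Qed.

Lemma polyb_add f g : polyb f -> polyb g -> polyb (fun n => f n + g n).
Proof.
case=> k kP [l lP]; exists (k + l) => n; rewrite mulnDl leq_add //.
  by apply: leq_trans (kP n) _; rewrite leq_mul // leq_pexp2l // leq_addr.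
by apply: leq_trans (lP n) _; rewrite leq_mul // leq_pexp2l // leq_addl.
Qed.

Lemma polyb_mul f g : polyb f -> polyb g -> polyb (fun n => f n * g n).
Proof.
(* One number must exceed both the coefficient [k * l] and the exponent [k + l]. *)
case=> k kP [l lP]; exists (k * l + k + l) => n.
apply: leq_trans (leq_mul (kP n) (lP n)) _; rewrite mulnACA -expnD.
by apply: leq_mul; [lia|rewrite leq_pexp2l //; lia].
Qed.

Lemma polyb_exp f k : polyb f -> polyb (fun n => f n ^ k).
Proof.
move=> pf; elim: k => [|k IH]; first exact: (polyb_const 1).
by apply: polyb_le (polyb_mul pf IH) => n; rewrite expnS.
Qed.

Lemma prog_poly_time (R : finType) (P : prog R) (C : nat -> nat) f : polyb C ->
  (forall x, exists c s, [/\ runs (@pcode _ P) x (pstart P) (pinit R) c None s,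
     c <= C (size x) & out s = f x]) -> poly_time f.
Proof.
move=> pC H; have [k kP] : polyb (fun n => C n * (2 * C n + 6) + 2 * C n + 4).
  by repeat (first [apply: polyb_add | apply: polyb_mul | apply: polyb_const | exact: pC]).
exists (machine P), k; split=> // x; have [c [s [hr cb <-]]] := H x.
have [n [nb h1 h2]] := machine_correct hr; exists n; split=> //.
apply: leq_trans nb (leq_trans _ (kP _)); nia.
Qed.

(** * A program logic for pointer machines *)

Section Programs.
Variable R : finType.
Implicit Types (s : pstate R) (x : seq bool) (P : prog R).

Definition imap (Q Q' : Type) (g : Q -> Q') (i : instr R Q) : instr R Q' :=
  match i with
  | IInc r q => IInc r (g q)
  | IZero r q => IZero r (g q)
  | IOut b q => IOut b (g q)
  | ITest t q1 q2 => ITest t (g q1) (g q2)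
  end.

(** Leaving a subprogram becomes a jump to [ex] in the surrounding program. *)
Definition link (Q Q' : Type) (emb : Q -> Q') (ex : option Q') (o : option Q) :=
  if o is Some q then Some (emb q) else ex.

Lemma runs_embed Q Q' (code : Q -> instr R (option Q)) (code' : Q' -> instr R (option Q'))
    emb ex x o s c o' s' :
  (forall q, code' (emb q) = imap (link emb ex) (code q)) ->
  runs code x o s c o' s' ->
  runs code' x (link emb ex o) s c (link emb ex o') s'.
Proof.
move=> H; elim=> {o s c o' s'} [o s|q s c o s' _ IH]; first exact: runs0.
apply: runsS; rewrite H.
by case: (code q) IH => [r o1|r o1|b o1|t o1 o2] //=; case: ifP.
Qed.

Lemma runs_trans Q (code : Q -> instr R (option Q)) x o1 s1 c1 o2 s2 c2 o3 s3 :
  runs code x o1 s1 c1 o2 s2 -> runs code x o2 s2 c2 o3 s3 ->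
  runs code x o1 s1 (c1 + c2) o3 s3.
Proof. by elim=> {o1 s1 c1 o2 s2} // q s c o s' _ IH /IH h; apply: runsS. Qed.

Definition pskip : prog R := @Prog R void None (fun v => match v with end).
Definition pinc r : prog R := @Prog R unit (Some tt) (fun=> IInc r None).
Definition pzero r : prog R := @Prog R unit (Some tt) (fun=> IZero r None).
Definition pout b : prog R := @Prog R unit (Some tt) (fun=> IOut b None).

Definition pseq P1 P2 : prog R :=
  let ex := omap inr (pstart P2) in
  @Prog R (pctl P1 + pctl P2)%type (link inl ex (pstart P1))
    (fun q => match q with
              | inl q1 => imap (link inl ex) (pcode q1)
              | inr q2 => imap (link inr None) (pcode q2)
              end).

Definition pif t P1 P2 : prog R :=
  @Prog R (option (pctl P1 + pctl P2))%type (Some None)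
    (fun q => match q with
              | None => ITest t (link (Some \o inl) None (pstart P1))
                                (link (Some \o inr) None (pstart P2))
              | Some (inl q1) => imap (link (Some \o inl) None) (pcode q1)
              | Some (inr q2) => imap (link (Some \o inr) None) (pcode q2)
              end).

Definition pwhile t P : prog R :=
  @Prog R (option (pctl P)) (Some None)
    (fun q => match q with
              | None => ITest t (link Some (Some None) (pstart P)) None
              | Some q1 => imap (link Some (Some None)) (pcode q1)
              end).

(** A partial description of the registers; those not listed may hold anything, so scratch registers
    are forgotten by weakening. *)
Definition env := seq (R * nat).
Definition aset (r : R) (v : nat) (al : env) : env :=
  (r, v) :: [seq p <- al | p.1 != r].
Definition holds (al : env) s := forall p, p \in al -> regs s p.1 = p.2.

Definition hoare x (al : env) P (al' : env) (o : seq bool) (C : nat) :=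
  forall s, holds al s -> exists c s',
    [/\ runs (@pcode _ P) x (pstart P) s c None s', c <= C, holds al' s' &
        out s' = out s ++ o].

Lemma holds_aset r v al e o o' : holds al (PState e o) ->
  holds (aset r v al) (PState (rupd e r v) o').
Proof.
move=> H [i w]; rewrite inE /= => /orP[/eqP[-> ->]|]; first by rewrite /rupd eqxx.
by rewrite mem_filter /= /rupd => /andP[/negbTE-> /H].
Qed.

Lemma holds_sub al al' s : {subset al' <= al} -> holds al s -> holds al' s.
Proof. by move=> sub H p /sub /H. Qed.

Lemma aset_aset r v w al : aset r v (aset r w al) = aset r v al.
Proof.
rewrite /aset /= eqxx /= -filter_predI; congr cons; apply: eq_filter => p /=.
by rewrite andbb.
Qed.

Lemma mem_aset r v w i al : i != r -> (i, w) \in al -> (i, w) \in aset r v al.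
Proof. by move=> ir m; rewrite inE mem_filter /= ir m orbT. Qed.

Lemma hoare_pre x al0 al P al' o C : {subset al0 <= al} ->
  hoare x al0 P al' o C -> hoare x al P al' o C.
Proof. by move=> sub H s /(holds_sub sub) /H. Qed.

Lemma hoare_post x al0 al P al' o C : {subset al' <= al0} ->
  hoare x al P al0 o C -> hoare x al P al' o C.
Proof.
by move=> sub H s /H[c [s' [h1 h2 /(holds_sub sub) h3 h4]]]; exists c, s'.
Qed.

Lemma hoare_cost x al P al' o C C' : C <= C' ->
  hoare x al P al' o C -> hoare x al P al' o C'.
Proof.
move=> le H s /H[c [s' [h1 h2 h3 h4]]]; exists c, s'; split=> //.
exact: leq_trans le.
Qed.

Lemma hoare_skip x al : hoare x al pskip al [::] 0.
Proof. by move=> s h; exists 0, s; split=> //; [apply: runs0|rewrite cats0]. Qed.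

Lemma hoare_inc x al r v : (r, v) \in al -> hoare x al (pinc r) (aset r v.+1 al) [::] 1.
Proof.
move=> m s h; have /= e := h _ m; exists 1, (PState (rupd (regs s) r v.+1) (out s)).
split=> //; last by rewrite cats0.
  by apply: runsS; rewrite /= e; apply: runs0.
by apply: (holds_aset (o := out s)); case: s h {e}.
Qed.

Lemma hoare_zero x al r : hoare x al (pzero r) (aset r 0 al) [::] 1.
Proof.
move=> s h; exists 1, (PState (rupd (regs s) r 0) (out s)).
split=> //; last by rewrite cats0.
  by apply: runsS; apply: runs0.
by apply: (holds_aset (o := out s)); case: s h.
Qed.

Lemma hoare_out x al b : hoare x al (pout b) al [:: b] 1.
Proof.
move=> s h; exists 1, (PState (regs s) (rcons (out s) b)).
by split=> //; [apply: runsS; apply: runs0|rewrite cats1].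
Qed.

Lemma hoare_seq al2 x al1 al3 P1 P2 o1 o2 C1 C2 :
  hoare x al1 P1 al2 o1 C1 -> hoare x al2 P2 al3 o2 C2 ->
  hoare x al1 (pseq P1 P2) al3 (o1 ++ o2) (C1 + C2).
Proof.
move=> h1 h2 s /h1[c1 [s1 [r1 b1 /h2[c2 [s2 [r2 b2 h3 e2]]] e1]]].
exists (c1 + c2), s2; split=> //; first 1 last.
- exact: leq_add.
- by rewrite e2 e1 catA.
apply: runs_trans (runs_embed (code' := @pcode _ (pseq P1 P2)) (emb := inl)
  (ex := omap inr (pstart P2)) _ r1) _ => //=.
rewrite (_ : omap inr _ = link inr None (pstart P2)); last by case: (pstart P2).
exact: (runs_embed (code' := @pcode _ (pseq P1 P2)) (emb := inr) (ex := None) _ r2).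
Qed.

Lemma hoare_if x al t P1 P2 b al' o C :
  (forall s, holds al s -> teval x s t = b) ->
  hoare x al (if b then P1 else P2) al' o C ->
  hoare x al (pif t P1 P2) al' o C.+1.
Proof.
move=> tb H s hs; have := H s hs; have := tb s hs.
case: b {H tb} => tb [c [s' [r1 cC h1 h2]]]; exists c.+1, s'; split=> //;
  apply: runsS; rewrite /= tb.
- exact: (runs_embed (code' := @pcode _ (pif t P1 P2)) (emb := Some \o inl) (ex := None) _ r1).
- exact: (runs_embed (code' := @pcode _ (pif t P1 P2)) (emb := Some \o inr) (ex := None) _ r1).
Qed.

Lemma hoare_while x t P (al : nat -> env) n o C :
  (forall k s, k <= n -> holds (al k) s -> teval x s t = (k < n)) ->
  (forall k, k < n -> hoare x (al k) P (al k.+1) (o k) C) ->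
  hoare x (al 0) (pwhile t P) (al n) (flatten [seq o k | k <- iota 0 n]) (n * C.+1).+1.
Proof.
move=> tP bP; suff H m k : k + m = n ->
    hoare x (al k) (pwhile t P) (al n) (flatten [seq o i | i <- iota k m]) (m * C.+1).+1.
  by apply: H; rewrite add0n.
elim: m k => [|m IH] k km s hs.
  have tk := tP k s _ hs; exists 1, s; split=> //; last by rewrite cats0.
    by apply: runsS; rewrite /= tk; [have -> : (k < n) = false by lia|lia]; apply: runs0.
  by move: hs; rewrite -km addn0.
have lt : k < n by lia.
have [c1 [s1 [r1 b1 h1 e1]]] := bP k lt s hs.
have [|c2 [s2 [r2 b2 h2 e2]]] := IH k.+1 _ s1 h1; first by lia.
exists (c1 + c2).+1, s2; split=> //; last by rewrite e2 e1 /= catA.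
  apply: runsS; rewrite /= (tP k s (ltnW lt) hs) lt.
  apply: runs_trans r2.
  exact: (runs_embed (code' := @pcode _ (pwhile t P)) (emb := Some) (ex := Some None) _ r1).
by rewrite mulSn; lia.
Qed.

Definition pfor i m P := pseq (pzero i) (pwhile (TLt i m) (pseq P (pinc i))).
Definition cfor n C := 1 + (n * (C + 1).+1).+1.

Lemma hoare_for_gen x i m P (al : nat -> env) n o C : i != m ->
  (forall k, (m, n) \in al k) ->
  (forall k, k < n -> hoare x (aset i k (al k)) P (aset i k (al k.+1)) (o k) C) ->
  hoare x (al 0) (pfor i m P) (aset i n (al n)) (flatten [seq o k | k <- iota 0 n])
    (cfor n C).
Proof.
move=> im mn bP; rewrite -[flatten _]cat0s.
apply: (hoare_seq (al2 := aset i 0 (al 0))); first exact: hoare_zero.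
apply: (hoare_while (al := fun k => aset i k (al k))) => [k s le hs|k lt].
  rewrite /= (hs (i, k)) ?inE ?eqxx // (hs (m, n)) //.
  by apply: mem_aset; rewrite // eq_sym.
rewrite -[o k]cats0; apply: hoare_seq (bP k lt) _.
by rewrite -[aset i k.+1 _](aset_aset i k.+1 k); apply: hoare_inc; rewrite inE eqxx.
Qed.

Lemma aset_notin i k al : i \notin map fst al -> aset i k al = (i, k) :: al.
Proof.
move=> ni; rewrite /aset; congr cons; apply/all_filterP/allP=> p pal /=.
by apply: contraNneq ni => <-; apply: map_f.
Qed.

Lemma hoare_for x i m P al n o C : i \notin map fst al -> (m, n) \in al ->
  (forall k, k < n -> hoare x ((i, k) :: al) P ((i, k) :: al) (o k) C) ->
  hoare x al (pfor i m P) al (flatten [seq o k | k <- iota 0 n]) (cfor n C).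
Proof.
move=> ni mn bP; apply: (hoare_post (al0 := aset i n al)).
  by move=> p pal; rewrite aset_notin // inE pal orbT.
apply: (hoare_for_gen (al := fun=> al)) => // [|k lt]; last by rewrite aset_notin //; apply: bP.
by apply: contraNneq ni => ->; apply/mapP; exists (m, n).
Qed.

Definition pcopy i j := pseq (pzero i) (pwhile (TLt i j) (pinc i)).

Lemma hoare_copy x al i j v : i != j -> (j, v) \in al ->
  hoare x al (pcopy i j) (aset i v al) [::] (1 + (v * 2).+1).
Proof.
move=> ij jv; rewrite -[[::]]cat0s; apply: hoare_seq; first exact: hoare_zero.
have -> : [::] = flatten [seq [::] | k <- iota 0 v] :> seq bool by elim: (iota 0 v).
apply: (hoare_while (al := fun k => aset i k al)) => [k s le hs|k lt].
  rewrite /= (hs (i, k)) ?inE ?eqxx // (hs (j, v)) //.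
  by apply: mem_aset; rewrite // eq_sym.
by rewrite -[aset i k.+1 _](aset_aset i k.+1 k); apply: hoare_inc; rewrite inE eqxx.
Qed.

Definition padd t i j := pfor t j (pinc i).

Lemma flatten_nil (T U : Type) (r : seq T) : flatten [seq [::] | k <- r] = [::] :> seq U.
Proof. by elim: r. Qed.

Lemma aset_id i v al : (i, v) \in al -> {subset aset i v al <= al}.
Proof.
by move=> m p; rewrite inE mem_filter => /orP[/eqP->|/andP[]].
Qed.

Lemma hoare_add x al t i j a b : t != i -> t != j -> i != j ->
  (i, a) \in al -> (j, b) \in al ->
  hoare x al (padd t i j) (aset t b (aset i (a + b) al)) [::] (cfor b 1).
Proof.
move=> ti tj ij ia jb; apply: (hoare_pre (al0 := aset i (a + 0) al)).
  by rewrite addn0; apply: aset_id.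
rewrite -(flatten_nil _ (iota 0 b)).
apply: (hoare_for_gen (al := fun k => aset i (a + k) al)) => // [k|k lt].
  by apply: mem_aset; rewrite // eq_sym.
apply: (hoare_post (al0 := aset i (a + k).+1 (aset t k (aset i (a + k) al)))).
  move=> p; rewrite addnS !(inE, mem_filter) /=.
  case: (p =P (t, k)) => [->|_] /=; first by rewrite ti orbT.
  by case: (p =P (i, (a + k).+1)) => //= _ /and3P[-> -> ->]; rewrite !orbT.
by apply: hoare_inc; apply: mem_aset; rewrite ?inE ?eqxx // eq_sym.
Qed.

(* [r := r * j] with scratch registers [t1 t2 t3]. *)
Definition pmul t1 t2 t3 r j :=
  pseq (pzero t3) (pseq (pfor t2 j (padd t1 t3 r)) (pcopy r t3)).
Definition cmul a b := 1 + (cfor b (cfor a 1) + (1 + (a * b * 2).+1)).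

Lemma hoare_mul x al t1 t2 t3 r j a b : uniq [:: t1; t2; t3; r; j] ->
  [disjoint map fst al & [:: t1; t2; t3]] -> (r, a) \in al -> (j, b) \in al ->
  hoare x al (pmul t1 t2 t3 r j) (aset r (a * b) al) [::] (cmul a b).
Proof.
rewrite /= !inE !negb_or => /and5P[/and4P[t12 t13 t1r t1j] /and3P[t23 t2r t2j] /andP[t3r t3j] rj _].
move=> dis ra jb.
have nal t : t \in [:: t1; t2; t3] -> forall p, p \in al -> p.1 != t.
  move=> tt p pal; apply: contraTneq dis => pt; apply/pred0Pn; exists t => /=.
  by rewrite tt andbT -pt map_f.
have n3 := nal t3 _; have n2 := nal t2 _; have n1 := nal t1 _.
rewrite -[[::]]cat0s; apply: hoare_seq; first exact: hoare_zero.
rewrite -[[::]]cat0s -{1}(flatten_nil _ (iota 0 b)).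
apply: (hoare_seq (al2 := aset t3 (a * b) al)).
  apply: (hoare_post (al0 := aset t2 b (aset t3 (a * b) al))).
    move=> p; rewrite !(inE, mem_filter) => /orP[/eqP->|/andP[p3 pal]] /=.
      by rewrite eqxx [t3 == t2]eq_sym t23 orbT.
    by rewrite p3 pal n2 ?inE ?eqxx ?orbT.
  rewrite -{1}(muln0 a).
  apply: (hoare_for_gen (al := fun k => aset t3 (a * k) al)) => // [k|k lt].
    by apply: mem_aset; rewrite // eq_sym.
  apply: (hoare_post (al0 := aset t1 a (aset t3 (a * k + a) (aset t2 k (aset t3 (a * k) al))))).
    move=> p; rewrite mulnSr !(inE, mem_filter) /=.
    case: (p =P (t2, k)) => [->|_] /=; first by rewrite t23 [t2 == t1]eq_sym t12 /= !orbT.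
    case: (p =P (t3, a * k + a)) => [->|_] /=; first by rewrite [t3 == t1]eq_sym t13 /= !orbT.
    by move=> /and3P[-> -> pal]; rewrite pal n1 ?inE ?eqxx ?orbT.
  apply: hoare_add => //.
    by apply: mem_aset; rewrite 1?eq_sym // inE eqxx.
  by do 2 (apply: mem_aset; first by rewrite eq_sym).
apply: (hoare_post (al0 := aset r (a * b) (aset t3 (a * b) al))).
  move=> p; rewrite !(inE, mem_filter) /=.
  case: (p =P (r, _)) => //= _ /andP[-> pal].
  by rewrite pal n3 ?inE ?eqxx ?orbT.
by apply: hoare_copy; rewrite 1?eq_sym // inE eqxx.
Qed.

(** The count is fixed with the program: repetition is unrolled in the control and takes no
    register. *)
Fixpoint piter k P := if k is k'.+1 then pseq P (piter k' P) else pskip.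

Definition pouts (bs : seq bool) := foldr (fun b => pseq (pout b)) pskip bs.

Lemma hoare_outs x al bs : hoare x al (pouts bs) al bs (size bs).
Proof.
elim: bs => [|b bs IH]; first exact: hoare_skip.
by rewrite -[b :: bs]cat1s -[size _]add1n; apply: hoare_seq IH; apply: hoare_out.
Qed.

Definition pseqs (T : Type) (f : T -> prog R) (ks : seq T) :=
  foldr (fun k => pseq (f k)) pskip ks.

Lemma hoare_seqs (T : Type) x al (f : T -> prog R) o C ks :
  (forall k, hoare x al (f k) al (o k) C) ->
  hoare x al (pseqs f ks) al (flatten [seq o k | k <- ks]) (size ks * C).
Proof.
move=> H; elim: ks => [|k ks IH]; first exact: hoare_skip.
by rewrite mulSn; apply: hoare_seq IH; apply: H.
Qed.

(** A decision tree. Its size is exponential in the number of tests, but that number does not depend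
    on the input. *)
Fixpoint gather (ts : seq (test R)) (k : seq bool -> prog R) : prog R :=
  if ts is t :: ts' then
    pif t (gather ts' (fun bs => k (true :: bs))) (gather ts' (fun bs => k (false :: bs)))
  else k [::].

Lemma hoare_gather x al ts k bs al' o C :
  (forall s, holds al s -> [seq teval x s t | t <- ts] = bs) ->
  hoare x al (k bs) al' o C -> hoare x al (gather ts k) al' o (size ts + C).
Proof.
elim: ts k bs => [|t ts IH] k bs H hk s hs.
  by move: (hk); rewrite -(H s hs) => hk'; apply: hk' hs.
have := H s hs; case: bs H hk => [//|b bs] H hk [tb tbs].
apply: (hoare_if (b := b)) hs => [s' /H[->] //|].
by case: b H hk {tb} => H hk; apply: IH hk => s' /H[].
Qed.

(** Meant for silent programs whose register values depend on the input length alone. *)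
Definition phoare (al : nat -> env) P (al' : nat -> env) := exists2 C, polyb C &
  forall x, hoare x (al (size x)) P (al' (size x)) [::] (C (size x)).

Lemma phoare_seq al2 al1 al3 P1 P2 : phoare al1 P1 al2 -> phoare al2 P2 al3 ->
  phoare al1 (pseq P1 P2) al3.
Proof.
case=> C1 p1 h1 [C2 p2 h2]; exists (fun n => C1 n + C2 n); first exact: polyb_add.
by move=> x; rewrite -[[::]]cat0s; apply: hoare_seq (h1 x) (h2 x).
Qed.

Lemma phoare_skip al : phoare al pskip al.
Proof. by exists (fun=> 0) => [|x]; [apply: polyb_const|apply: hoare_skip]. Qed.

Lemma phoare_inc al r v : (forall n, (r, v n) \in al n) ->
  phoare al (pinc r) (fun n => aset r (v n).+1 (al n)).
Proof. by move=> H; exists (fun=> 1) => [|x]; [apply: polyb_const|apply: hoare_inc]. Qed.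

Lemma phoare_copy al i j v : i != j -> polyb v -> (forall n, (j, v n) \in al n) ->
  phoare al (pcopy i j) (fun n => aset i (v n) (al n)).
Proof.
move=> ij pv H; exists (fun n => 2 + v n * 2); last by move=> x; apply: hoare_copy.
by apply: polyb_add (polyb_const 2) (polyb_mul pv (polyb_const 2)).
Qed.

Lemma polyb_cfor f g : polyb f -> polyb g -> polyb (fun n => cfor (f n) (g n)).
Proof.
move=> pf pg; apply: polyb_le (polyb_add (polyb_const 2) (polyb_mul pf (polyb_add pg (polyb_const 2)))).
by move=> n; rewrite /cfor; lia.
Qed.

Lemma phoare_add al t i j a b : t != i -> t != j -> i != j -> polyb b ->
  (forall n, (i, a n) \in al n) -> (forall n, (j, b n) \in al n) ->
  phoare al (padd t i j) (fun n => aset t (b n) (aset i (a n + b n) (al n))).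
Proof.
move=> ti tj ij pb ia jb; exists (fun n => cfor (b n) 1); last by move=> x; apply: hoare_add.
exact: polyb_cfor (polyb_const 1).
Qed.

Lemma phoare_mul al t1 t2 t3 r j a b : uniq [:: t1; t2; t3; r; j] ->
  (forall n, [disjoint map fst (al n) & [:: t1; t2; t3]]) -> polyb a -> polyb b ->
  (forall n, (r, a n) \in al n) -> (forall n, (j, b n) \in al n) ->
  phoare al (pmul t1 t2 t3 r j) (fun n => aset r (a n * b n) (al n)).
Proof.
move=> u d pa pb ra jb; exists (fun n => cmul (a n) (b n)); last by move=> x; apply: hoare_mul.
apply: polyb_le (polyb_add (polyb_const 4) (polyb_add (polyb_cfor pb (polyb_cfor pa (polyb_const 1)))
  (polyb_mul (polyb_mul pa pb) (polyb_const 2)))).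
by move=> n; rewrite /cmul; lia.
Qed.

Lemma phoare_sub al al0 P al' : (forall n, {subset al' n <= al0 n}) ->
  phoare al P al0 -> phoare al P al'.
Proof. by move=> sub [C pC H]; exists C => // x; apply: hoare_post (H x). Qed.

Lemma phoare_piter_inc al r k : (forall n, (r, 0) \in al n) ->
  phoare al (piter k (pinc r)) (fun n => aset r k (al n)).
Proof.
move=> H; suff G m : phoare (fun n => aset r m (al n)) (piter k (pinc r))
    (fun n => aset r (m + k) (al n)).
  have [C pC h] := G 0; exists C => // x; apply: hoare_pre (h x).
  by apply: aset_id.
elim: k m => [|k IH] m; first by rewrite addn0; apply: phoare_skip.
rewrite -addSnnS /=; apply: phoare_seq (IH m.+1).
apply: (@phoare_sub _ (fun n => aset r m.+1 (aset r m (al n)))).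
  by move=> n; rewrite aset_aset.
by apply: (phoare_inc (v := fun=> m)) => n; rewrite inE eqxx.
Qed.

Lemma phoare_pow al t1 t2 t3 r j a b k : uniq [:: t1; t2; t3; r; j] ->
  (forall n, [disjoint map fst (al n) & [:: t1; t2; t3]]) -> polyb a -> polyb b ->
  (forall n, (r, a n) \in al n) -> (forall n, (j, b n) \in al n) ->
  phoare al (piter k (pmul t1 t2 t3 r j)) (fun n => aset r (a n * b n ^ k) (al n)).
Proof.
move=> u d pa pb ra jb; suff G m : phoare (fun n => aset r (a n * b n ^ m) (al n))
    (piter k (pmul t1 t2 t3 r j)) (fun n => aset r (a n * b n ^ (m + k)) (al n)).
  have [C pC h] := G 0; exists C => // x; apply: hoare_pre (h x).
  by rewrite expn0 muln1; apply: aset_id.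
elim: k m => [|k IH] m; first by rewrite addn0; apply: phoare_skip.
rewrite -addSnnS /=; apply: phoare_seq (IH m.+1).
apply: (@phoare_sub _ (fun n => aset r (a n * b n ^ m * b n) (aset r (a n * b n ^ m) (al n)))).
  by move=> n; rewrite aset_aset expnSr mulnA.
apply: (phoare_mul (a := fun n => a n * b n ^ m)) => // [n||n|n].
- apply/pred0P=> i /=; apply/negP=> /andP[]; rewrite inE => /orP[/eqP->|/mapP[p]].
    move: u; rewrite /= !inE !negb_or => /and4P[/and4P[_ _ t1r _] /and3P[_ t2r _] /andP[t3r _] _].
    by case/or3P=> /eqP E; [move: t1r|move: t2r|move: t3r]; rewrite E eqxx.
  rewrite mem_filter => /andP[_ pal] -> ip.
  by have /pred0P/(_ p.1) := d n; rewrite /= ip andbT map_f.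
- exact: polyb_mul pa (polyb_exp _ pb).
- by rewrite inE eqxx.
- apply: mem_aset => //; move: u; rewrite /= !inE !negb_or => /and5P[_ _ _].
  by rewrite eq_sym.
Qed.

Lemma phoare_size al r : (forall n, (r, 0) \in al n) ->
  phoare al (pwhile (TIn r) (pinc r)) (fun n => aset r n (al n)).
Proof.
move=> H; exists (fun n => (n * 2).+1).
  apply: polyb_le (polyb_add (polyb_const 1) (polyb_mul polyb_id (polyb_const 2))).
  by move=> n; rewrite add1n.
move=> x; apply: (hoare_pre (al0 := aset r 0 (al (size x)))).
  by apply: aset_id.
rewrite -(flatten_nil _ (iota 0 (size x))).
apply: (hoare_while (al := fun k => aset r k (al (size x)))) => [k s le hs|k lt].
  by rewrite /= (hs (r, k)) // inE eqxx.
by rewrite -[aset r k.+1 _](aset_aset r k.+1 k); apply: hoare_inc; rewrite inE eqxx.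
Qed.
End Programs.

(** * Computation tableaux as conflict systems *)

Section Tableau.
Variable M : TM.
Local Notation Q := (tm_state M).
Local Notation Sy := (tm_sym M).
Local Notation blank := (@tm_blank M).
Local Notation b0 := (@tm_b0 M).
Local Notation b1 := (@tm_b1 M).
Hypothesis bl0 : blank != b0.
Hypothesis bl1 : blank != b1.
Hypothesis b01 : b0 != b1.

(* A cell stores the state, the symbol under the head and the symbols in a
   window of three tape squares; the tape is drawn relative to the head. *)
Definition cellval : finType := (Q * Sy * (Sy * Sy * Sy))%type.
Definition cv_q (a : cellval) := a.1.1.
Definition cv_h (a : cellval) := a.1.2.
Definition cv_l (a : cellval) := a.2.1.1.
Definition cv_m (a : cellval) := a.2.1.2.
Definition cv_r (a : cellval) := a.2.2.

(** A halted machine rewrites its symbol and stays, so a run can be padded to exactly [T] steps. *)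
Definition tstep (q : Q) (h : Sy) : Q * Sy * move :=
  if @tm_halt M q then (q, h, Stay) else @tm_delta M q h.

(** * Local rules, depending on the position only through finitely many booleans *)

Section Kinds.
Variable kd : seq bool.
Definition k_row0 := nth false kd 0.
Definition k_rowT := nth false kd 1.
Definition k_ltS := nth false kd 2.
Definition k_preS := nth false kd 3.
Definition k_eqS := nth false kd 4.
Definition k_postS := nth false kd 5.
Definition k_ltE := nth false kd 6.
Definition k_eqE := nth false kd 7.
Definition k_postE := nth false kd 8.
Definition k_ltF := nth false kd 9.
Definition k_bit := nth false kd 10.
Definition k_right := nth false kd 11.
Definition k_down := nth false kd 12.

(* Row 0 holds [enc_pair x w]: blanks before column [cS], the doubled bits of
   [x] up to column [cE], the separator, then up to column [cF] the unknown
   witness [w], padded with blanks. *)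
Definition ok_init (y : Sy) : bool :=
  if k_ltS then y == blank else
  if k_ltE then y == bit_sym M k_bit else
  if k_eqE then y == b0 else
  if k_postE then y == b1 else
  if k_ltF then [|| y == b0, y == b1 | y == blank] else y == blank.

(* The value [None] is never allowed: its conflict edges only serve to connect
   the graph. Acceptance is required at a single cell, so that freeing that cell
   makes the whole system satisfiable. *)
Definition forb (a : option cellval) : bool :=
  if a is Some a then
    [|| k_eqS && (cv_m a != cv_h a),
        k_row0 && ((cv_q a != @tm_start M) || ~~ ok_init (cv_m a)) |
        [&& k_rowT, k_postS & ~~ [&& cv_h a == b1, cv_m a != b0 & cv_m a != b1]]]
  else true.

Definition next_q (a : cellval) : Q := (tstep (cv_q a) (cv_h a)).1.1.
(** A head move shifts the whole drawing by one column the other way; the written symbol then lands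
    just before, on or just after the head column. *)
Definition next_m (a : cellval) : Sy :=
  let: (_, w, m) := tstep (cv_q a) (cv_h a) in
  match m with
  | Stay => if k_eqS then w else cv_m a
  | MoveR => if k_preS then w else cv_r a
  | MoveL => if k_postS then w else cv_l a
  end.

(** Agreement of overlapping windows makes each window the true neighbourhood, so that the vertical
    rule involves two cells only. From the input on, row 0 forbids a non-blank after a blank, so the
    witness has a definite end. *)
Definition cell_conf (d : option bool) (a b : option cellval) : bool :=
  match d with
  | None => (a != b) || forb a
  | Some false => k_right &&
    match a, b with
    | Some a, Some b =>
      ~~ [&& cv_q a == cv_q b, cv_h a == cv_h b, cv_m a == cv_l b & cv_r a == cv_m b]
      || [&& k_row0, ~~ k_ltS, cv_m a == blank & cv_m b != blank]
    | None, _ => true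
    | _, _ => false
    end
  | Some true => k_down &&
    match a, b with
    | Some a, Some b => ~~ ((cv_q b == next_q a) && (cv_m b == next_m a))
    | None, _ => true
    | _, _ => false
    end
  end.
End Kinds.

Variables (x : seq bool) (W0 T : nat).
Definition cS := T.+1.
Definition cE := cS + 2 * size x.
Definition cF := cS + (2 * size x + 2 + W0).
(** Row [t] is reliable only from column [t] to column [cW - t - 1]; with this width, column
    [cS.+1], where acceptance is tested, is the last reliable one in row [T]. *)
Definition cW := (cS + cS).+1.

Definition kind (t j : nat) : seq bool :=
  [:: t == 0; t == T; j < cS; j == T; j == cS; j == cS.+1; j < cE; j == cE;
      j == cE.+1; j < cF; nth false x (j - cS)./2; j.+1 < cW; t.+1 < cS].

Definition gridV : finType := ('I_cS * 'I_cW)%type.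
Definition grid_nb (v : gridV) (d : option bool) : gridV :=
  match d with
  | None => v
  | Some false => (v.1, insubd v.2 v.2.+1)
  | Some true => (insubd v.1 v.1.+1, v.2)
  end.
Definition grid_conf (v : gridV) := cell_conf (kind v.1 v.2).

(* Square [i] of the tape of [c], drawn so that the head is at square [cS.+1]. *)
Definition square (c : config M) (i : nat) : Sy :=
  let: (_, l, h, r) := c in
  if i < cS.+1 then nth blank l (cS - i) else
  if i == cS.+1 then h else nth blank r (i - cS.+2).
Definition head_sym (c : config M) : Sy := let: (_, _, h, _) := c in h.
Definition cell_of (c : config M) (j : nat) : cellval :=
  (tm_state_of c, head_sym c, (square c j, square c j.+1, square c j.+2)).

Lemma square_head c : square c cS.+1 = head_sym c.
Proof. by case: c => [[[q l] h] r]; rewrite /= ltnn eqxx. Qed.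

Lemma next_q_cell c j : tm_state_of (tm_step c) = next_q (cell_of c j).
Proof.
case: c => [[[q l] h] r]; rewrite /next_q /tstep /cv_q /cv_h /=.
case: ifP => // _; case: tm_delta => [[q' w] []] //=; first by case: l.
by case: r.
Qed.

Lemma next_m_cell c t j : square (tm_step c) j.+1 = next_m (kind t j) (cell_of c j).
Proof.
case: c => [[[q l] h] r]; rewrite /next_m /tstep /cv_q /cv_h /cv_m /cv_l /cv_r /=.
rewrite /k_eqS /k_preS /k_postS /=.
have HS : cS = T.+1 by [].
have ifT (U : Type) (b : bool) (a a' : U) : b -> (if b then a else a') = a by move->.
have ifN (U : Type) (b : bool) (a a' : U) : b = false -> (if b then a else a') = a' by move->.
case: (@tm_halt M q) => /=.
  by rewrite ltnS eqSS; case: (ltngtP j cS).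
case: tm_delta => [[q' w] []].
- have -> : (if l is a :: l' then (q', l', a, w :: r) else (q', [::], blank, w :: r))
    = (q', behead l, head blank l, w :: r) by case: l.
  rewrite /square ltnS eqSS; case: (ltngtP j cS) => Hj.
  - by rewrite nth_behead [RHS]ifN ?[RHS]ifT; try lia; congr nth; lia.
  - case: (eqVneq j cS.+1) => [->|ne]; first by rewrite subnn.
    by rewrite [RHS]ifN ?[RHS]ifN; try lia; have -> : j.+1 - cS.+2 = (j - cS.+2).+1 by lia.
  - by rewrite Hj [RHS]ifN ?[RHS]ifT ?subnn ?nth0 //; lia.
- have -> : (if r is a :: r' then (q', w :: l, a, r') else (q', w :: l, blank, [::]))
    = (q', w :: l, head blank r, behead r) by case: r.
  rewrite /square ltnS eqSS; case: (ltngtP j cS) => Hj.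
  - case: (eqVneq j T) => [Ej|ne]; first by rewrite Ej HS subnn.
    by rewrite [RHS]ifT; [have -> : cS - j.+1 = (cS - j.+2).+1 by lia|lia].
  - rewrite [RHS]ifN ?[RHS]ifN ?[RHS]ifN; try lia.
    by rewrite nth_behead; congr nth; lia.
  - rewrite Hj [RHS]ifN ?[RHS]ifN ?[RHS]ifN; try lia.
    by rewrite subnn nth0.
- by rewrite /square ltnS eqSS; case: (ltngtP j cS).
Qed.

Definition accepting (c : config M) : bool :=
  [&& head_sym c == b1, square c cS.+2 != b0 & square c cS.+2 != b1].

Lemma accepting_output c : accepting c <-> tm_output c = [:: true].
Proof.
case: c => [[[q l] h] r]; rewrite /accepting /=.
have -> : (cS.+2 < cS.+1) = false by lia.
have -> : (cS.+2 == cS.+1) = false by lia.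
rewrite subnn; case: (h =P b1) => [_|_]; last by split=> //; case: ifP.
case: r => [|a r] /=; rewrite ?bl0 ?bl1 //=.
by case: (a =P b1) => [_|_]; rewrite ?andbF //=; case: (a =P b0).
Qed.

Section Run.
Variable w : seq bool.
Let y := enc_pair x w.
Definition run_at t := tm_run t (tm_init M y).

Lemma enc_pair_nth i : nth blank (map (bit_sym M) y) i =
  if i < 2 * size x then bit_sym M (nth false x i./2) else
  if i == 2 * size x then b0 else
  if i == (2 * size x).+1 then b1 else
  nth blank (map (bit_sym M) w) (i - (2 * size x).+2).
Proof.
rewrite /y /enc_pair; elim: x i => [|b x' IH] i.
  by rewrite muln0; case: i => [|[|i]] //=; rewrite !subSS subn0.
case: i => [|[|i]] /=; rewrite ?mulnS //= IH.
Qed.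

Lemma square_init j : square (tm_init M y) j.+1 =
  if j < cS then blank else nth blank (map (bit_sym M) y) (j - cS).
Proof.
rewrite /tm_init; have : 0 < size (map (bit_sym M) y).
  by rewrite size_map /y /enc_pair !size_cat /= !addnS.
case: (map _ y) => // a r _ /=; rewrite eqSS ltnS.
case: (ltngtP j cS) => [lt|gt|->] /=; first by rewrite nth_nil.
  by have -> : j - cS = (j.+1 - cS.+2).+1 by lia.
by rewrite subnn.
Qed.

Lemma start_init : tm_state_of (tm_init M y) = @tm_start M.
Proof. by rewrite /tm_init; case: map. Qed.

Hypothesis sw : size w <= W0.

Lemma ok_init_run t j : ok_init (kind t j) (square (tm_init M y) j.+1).
Proof.
rewrite square_init /ok_init /k_ltS /k_ltE /k_eqE /k_postE /k_ltF /k_bit /=.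
case: ltnP => [lt|le] //; rewrite enc_pair_nth.
have -> : (j - cS < 2 * size x) = (j < cE) by rewrite /cE; lia.
case: (j < cE) => //.
have -> : (j - cS == 2 * size x) = (j == cE) by rewrite /cE; lia.
case: (j == cE) => //.
have -> : (j - cS == (2 * size x).+1) = (j == cE.+1) by rewrite /cE; lia.
case: (j == cE.+1) => //.
case: ltnP => h.
  case: (ltnP (j - cS - (2 * size x).+2) (size w)) => lt.
    by rewrite (nth_map false) // /bit_sym; case: nth; rewrite eqxx ?orbT.
  by rewrite nth_default ?size_map // eqxx !orbT.
by rewrite nth_default // size_map; rewrite /cF in h; lia.
Qed.

Definition run_assign (v : gridV) : option cellval := Some (cell_of (run_at v.1) v.2).

Lemma nb_right (v : gridV) : v.2.+1 < cW -> val (grid_nb v (Some false)).2 = v.2.+1.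
Proof. by move=> lt; rewrite /= val_insubd lt. Qed.
Lemma nb_down (v : gridV) : v.1.+1 < cS -> val (grid_nb v (Some true)).1 = v.1.+1.
Proof. by move=> lt; rewrite /= val_insubd lt. Qed.

(** The disjunction excuses only the accepting cell, so that the same argument serves for
    satisfiability and for almost satisfiability. *)
Lemma run_assign_ok (v : gridV) d a b : grid_conf v d a b ->
  ((v.1 != T :> nat) || (v.2 != cS.+1 :> nat) || accepting (run_at T)) ->
  ~~ ((run_assign v == a) && (run_assign (grid_nb v d) == b)).
Proof.
move=> cf acc; apply/negP=> /andP[/eqP Ea /eqP Eb]; subst a b.
move: cf; rewrite /grid_conf; case: d => [[]|].
- rewrite /cell_conf; case/andP; rewrite /k_down /= => lt.
  rewrite /run_assign (nb_down lt) /= /cv_q /cv_m /=.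
  by rewrite (next_q_cell _ v.2) (next_m_cell _ v.1) !eqxx.
- rewrite /cell_conf; case/andP; rewrite /k_right /= => lt.
  rewrite /run_assign (nb_right lt) /cv_q /cv_h /cv_m /cv_l /cv_r /= !eqxx /=.
  case/and4P; rewrite /k_row0 /k_ltS /= => /eqP-> /= nS.
  rewrite /run_at /= !square_init (negbTE nS); have -> : (v.2.+1 < cS) = false.
    by apply/negbTE; rewrite -leqNgt leqW // leqNgt.
  move=> /eqP E1 /eqP; apply; case: (ltnP (v.2 - cS) (size y)) => h.
    by move: E1 bl0 bl1; rewrite (nth_map false) // /bit_sym; case: nth => <-; rewrite eqxx.
  by rewrite nth_default // size_map; apply: leq_trans h (leq_sub2r _ (leqnSn _)).
- rewrite /cell_conf eqxx /= /cv_m /cv_h /cv_q /k_eqS /k_row0 /k_rowT /k_postS /=.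
  case/or3P=> [/andP[/eqP-> ]|/andP[/eqP->]|/and3P[/eqP tT /eqP jS]].
  + by rewrite square_head eqxx.
  + by rewrite /run_at /= start_init eqxx ok_init_run.
  + by move: acc; rewrite tT jS !eqxx /accepting /= => ->.
Qed.
End Run.

Hypothesis leT : 2 * size x + 2 + W0 <= T.

Definition gridv (t j : nat) : gridV := (inord t : 'I_T.+1, inord j : 'I_(cS + cS).+1).

(** * Reading an accepting run off a satisfying assignment *)

Section Soundness.
Variable g : gridV -> option cellval.
Hypothesis gP : forall v d a b, grid_conf v d a b -> ~~ ((g v == a) && (g (grid_nb v d) == b)).

Let dflt : cellval := (@tm_start M, blank, (blank, blank, blank)).
Definition G t j : cellval := odflt dflt (g (gridv t j)).

Lemma gP' v d : grid_conf v d (g v) (g (grid_nb v d)) = false.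
Proof. by apply/negP=> /gP; rewrite !eqxx. Qed.

Lemma gridvE t j : t < cS -> j < cW -> val (gridv t j).1 = t /\ val (gridv t j).2 = j.
Proof. by move=> lt lj; rewrite /= !inordK. Qed.

Lemma g_Some t j : t < cS -> j < cW ->
  g (gridv t j) = Some (G t j) /\ forb (kind t j) (Some (G t j)) = false.
Proof.
move=> lt lj; have := gP' (gridv t j) None; rewrite /grid_conf /= eqxx /=.
have [e1 e2] := gridvE lt lj; rewrite /= in e1 e2; rewrite e1 e2 /G.
by case: (g _).
Qed.

Lemma gridv_right t j : t < cS -> j.+1 < cW -> grid_nb (gridv t j) (Some false) = gridv t j.+1.
Proof.
move=> lt lj; have [_ e2] := gridvE lt (ltnW lj).
congr pair; apply: val_inj; rewrite /= in e2; rewrite val_insubd /= e2.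
by rewrite -/cW lj inordK.
Qed.

Lemma gridv_down t j : t.+1 < cS -> j < cW -> grid_nb (gridv t j) (Some true) = gridv t.+1 j.
Proof.
move=> lt lj; have [e1 _] := gridvE (ltnW lt) lj.
congr pair; apply: val_inj; rewrite /= in e1; rewrite val_insubd /= e1.
by rewrite -/cS lt inordK.
Qed.

Lemma G_right t j : t < cS -> j.+1 < cW ->
  [/\ cv_q (G t j) = cv_q (G t j.+1), cv_h (G t j) = cv_h (G t j.+1),
      cv_m (G t j) = cv_l (G t j.+1), cv_r (G t j) = cv_m (G t j.+1) &
      t = 0 -> cS <= j -> cv_m (G t j) = blank -> cv_m (G t j.+1) = blank].
Proof.
move=> lt lj; have := gP' (gridv t j) (Some false).
rewrite gridv_right // (g_Some lt (ltnW lj)).1 (g_Some lt lj).1.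
have [e1 e2] := gridvE lt (ltnW lj).
rewrite /grid_conf e1 e2 /cell_conf /k_right /k_row0 /k_ltS [nth _ _ 11]/= lj /=.
move/negbT; rewrite negb_or negbK => /andP[/and4P[/eqP h1 /eqP h2 /eqP h3 /eqP h4] h5].
split=> // t0 le bl; apply/eqP; move: h5; rewrite bl t0 /= eqxx -leqNgt le /=.
by rewrite negbK.
Qed.

Lemma G_down t j : t.+1 < cS -> j < cW ->
  cv_q (G t.+1 j) = next_q (G t j) /\ cv_m (G t.+1 j) = next_m (kind t j) (G t j).
Proof.
move=> lt lj; have := gP' (gridv t j) (Some true).
rewrite gridv_down // (g_Some (ltnW lt) lj).1 (g_Some lt lj).1.
have [e1 e2] := gridvE (ltnW lt) lj.
rewrite /grid_conf e1 e2 /cell_conf /k_down [nth _ _ 12]/= lt andTb.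
by move/negbFE/andP=> [/eqP-> /eqP->].
Qed.

Lemma G_row t j : t < cS -> j < cW ->
  cv_q (G t j) = cv_q (G t cS) /\ cv_h (G t j) = cv_h (G t cS).
Proof.
move=> lt; have H i : i < cW -> cv_q (G t i) = cv_q (G t 0) /\ cv_h (G t i) = cv_h (G t 0).
  elim: i => // i IH li; have [h1 h2] := IH (ltnW li).
  by have [<- <- _ _ _] := G_right lt li.
move=> lj; have [-> ->] := H j lj; have [|-> ->] // := H cS.
by rewrite /cW; lia.
Qed.

Lemma G_head t : t < cS -> cv_m (G t cS) = cv_h (G t cS).
Proof.
move=> lt; have lS : cS < cW by rewrite /cW; lia.
have [_ /negbT] := g_Some lt lS; rewrite /= negb_or => /andP[].
by rewrite /k_eqS /= eqxx /= negbK => /eqP.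
Qed.

Lemma G_init j : j < cW -> cv_q (G 0 j) = @tm_start M /\ ok_init (kind 0 j) (cv_m (G 0 j)).
Proof.
move=> lj; have [_ /negbT] := g_Some (t := 0) isT lj; rewrite /forb /k_row0 [nth _ _ 0]/=.
by rewrite !negb_or !negbK => /and3P[_ /andP[/eqP-> ->] _].
Qed.

(** The separator occupies columns [cE] and [cE.+1], so the witness starts at [cE.+2]. *)
Definition wit_sym i := cv_m (G 0 (cE.+2 + i)).
Definition wit_len := find (fun i => wit_sym i == blank) (iota 0 W0).
Definition witness := [seq wit_sym i == b1 | i <- iota 0 wit_len].

Lemma wit_len_le : wit_len <= W0.
Proof. rewrite -[X in _ <= X](size_iota 0 W0); exact: find_size. Qed.

Lemma size_witness : size witness <= W0.
Proof. by rewrite size_map size_iota wit_len_le. Qed.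

Lemma wit_range i : i < W0 -> cE.+2 + i < cW.
Proof. by rewrite /cE /cW /cS => ?; lia. Qed.

Lemma wit_sym_ok i : i < W0 -> [|| wit_sym i == b0, wit_sym i == b1 | wit_sym i == blank].
Proof.
move=> lt; have [_] := G_init (wit_range lt).
rewrite /ok_init /k_ltS /k_ltE /k_eqE /k_postE /k_ltF /= -/(wit_sym i).
have -> : (cE.+2 + i < cS) = false by rewrite /cE; lia.
have -> : (cE.+2 + i < cE) = false by lia.
have -> : (cE.+2 + i == cE) = false by lia.
have -> : (cE.+2 + i == cE.+1) = false by lia.
by have -> : (cE.+2 + i < cF) by rewrite /cE /cF; lia.
Qed.

Lemma wit_sym_nth i : i < W0 -> nth blank (map (bit_sym M) witness) i = wit_sym i.
Proof.
move=> lt; case: (ltnP i wit_len) => h.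
  rewrite /witness -map_comp (nth_map 0) ?size_iota // nth_iota // add0n /=.
  have /negbT nb := before_find 0 h; rewrite nth_iota // add0n in nb.
  have := wit_sym_ok lt; rewrite (negbTE nb) orbF /bit_sym.
  by case: (wit_sym i =P b1) => [->|_] //= /orP[/eqP->|].
(* Beyond the first blank the horizontal rule of row 0 forces blanks, in agreement with the default
   value. *)
rewrite nth_default ?size_map ?size_iota //.
have e0 : wit_sym wit_len = blank.
  have hs : has (fun i => wit_sym i == blank) (iota 0 W0).
    by rewrite has_find size_iota; apply: leq_ltn_trans lt.
  by have /eqP := nth_find 0 hs; rewrite nth_iota ?add0n //; apply: leq_ltn_trans lt.
suff H k : wit_len + k < W0 -> wit_sym (wit_len + k) = blank.
  by rewrite -(subnKC h) H ?subnKC.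
elim: k => [|k IH] lk; first by rewrite addn0.
rewrite addnS in lk *; have e1 := IH (ltnW lk).
have := wit_range lk; rewrite /wit_sym addnS => lj.
have [_ _ _ _] := G_right (t := 0) isT lj; apply=> //.
by rewrite /cE; lia.
Qed.

Lemma G_row0 j : j < cW -> cv_m (G 0 j) = square (tm_init M (enc_pair x witness)) j.+1.
Proof.
move=> lj; rewrite square_init; have [_] := G_init lj.
rewrite /ok_init /k_ltS /k_ltE /k_eqE /k_postE /k_ltF /k_bit /=.
case: ltnP => [lt /eqP//|le]; rewrite enc_pair_nth.
have -> : (j - cS < 2 * size x) = (j < cE) by rewrite /cE; lia.
case: ltnP => [_ /eqP//|leE].
have -> : (j - cS == 2 * size x) = (j == cE) by rewrite /cE; lia.
case: (j =P cE) => [_ /eqP//|nE].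
have -> : (j - cS == (2 * size x).+1) = (j == cE.+1) by rewrite /cE; lia.
case: (j =P cE.+1) => [_ /eqP//|nE1].
case: ltnP => [ltF _|geF /eqP->].
  rewrite wit_sym_nth /wit_sym; last by rewrite /cF /cE in ltF leE nE nE1 *; lia.
  by congr (cv_m (G 0 _)); rewrite /cE in leE nE nE1 *; lia.
rewrite nth_default // size_map; apply: leq_trans size_witness _.
by rewrite /cF in geF; lia.
Qed.

Let c t := run_at witness t.

(** Windows at the border are unchecked on their outer side, and this uncertainty moves inwards by
    one column per row. State and head symbol are exempt, being constant along each row. *)
Lemma G_run t : t < cS ->
  [/\ cv_q (G t cS) = tm_state_of (c t), cv_h (G t cS) = head_sym (c t) &
      forall j, t <= j -> j + t < cW -> cv_m (G t j) = square (c t) j.+1].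
Proof.
elim: t => [|t IH] lt.
  have lS : cS < cW by rewrite /cW; lia.
  split.
  - by rewrite (G_init lS).1 /c /run_at /= start_init.
  - by rewrite -G_head // G_row0 // square_head.
  - by move=> j _; rewrite addn0 => lj; rewrite G_row0.
have [IHq IHh IHm] := IH (ltnW lt).
(* Both neighbours of column [j] are still reliable in row [t], which fixes the whole window. *)
have cellE j : t < j -> j + t.+1 < cW -> G t j = cell_of (c t) j.
  case: j => // j tj lj; have [|h1 h2 h3 _ _] := @G_right t j (ltnW lt); first by lia.
  have [|_ _ _ h4 _] := @G_right t j.+1 (ltnW lt); first by lia.
  have [|e1 e2] := @G_row t j.+1 (ltnW lt); first by lia.
  have m1 : cv_m (G t j) = square (c t) j.+1 by apply: IHm; lia.
  have m2 : cv_m (G t j.+1) = square (c t) j.+2 by apply: IHm; lia.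
  have m3 : cv_m (G t j.+2) = square (c t) j.+3 by apply: IHm; lia.
  rewrite /cell_of -IHq -IHh -e1 -e2 -m1 -m2 -m3 h3 -h4.
  by case: (G t j.+1) => [[q h] [[a b] r]].
have stepE : c t.+1 = tm_step (c t) by [].
have key j : t < j -> j + t.+1 < cW ->
    cv_q (G t.+1 j) = tm_state_of (c t.+1) /\ cv_m (G t.+1 j) = square (c t.+1) j.+1.
  move=> tj lj; have [|-> ->] := @G_down t j lt; first by lia.
  by rewrite cellE // stepE (next_q_cell _ j) (next_m_cell _ t).
have [||kq km] := key cS; [exact: ltnW|by rewrite /cW; lia|].
split=> // [|j tj lj]; last by case: (key j tj lj).
by rewrite -G_head // km square_head.
Qed.

Lemma G_accepting : accepting (c T).
Proof.
have lT : T < cS by [].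
have [h1 h2 h3] := G_run lT; rewrite /accepting -h2.
have lS : cS.+1 < cW by rewrite /cW /cS; lia.
rewrite -h3; first 1 last; try by rewrite /cW /cS; lia.
have [_ eh] := G_row lT lS; rewrite -eh.
have [_ /negbT] := g_Some lT lS; rewrite /= !negb_or => /and3P[_ _].
by rewrite /k_rowT /k_postS /= !eqxx /= negbK.
Qed.
End Soundness.

Lemma tableau_sat : conflict_sat grid_nb grid_conf <->
  exists w, size w <= W0 /\ tm_output (tm_run T (tm_init M (enc_pair x w))) = [:: true].
Proof.
split=> [[g gP]|[w [sw acc]]].
  exists (witness g); split; first exact: size_witness.
  by apply/accepting_output; exact: (G_accepting gP).
exists (run_assign w) => v d a b cf; apply: run_assign_ok => //.
by apply/orP; right; apply/accepting_output.
Qed.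

Lemma tableau_almost_sat : conflict_almost_sat grid_nb grid_conf.
Proof.
(* The run on the empty witness obeys all rules except possibly acceptance. *)
exists (gridv T cS.+1), (run_assign [::]) => v d a b nv _ cf.
apply: run_assign_ok => //; apply/orP; left.
rewrite -negb_and; apply: contra nv => /andP[/eqP h1 /eqP h2].
apply/eqP; case: v h1 h2 {cf} => t j /= h1 h2.
by congr pair; apply: val_inj; rewrite /= inordK // /cS; lia.
Qed.
End Tableau.

(** * Numbering the vertices of the grid graph *)

(* [rel] lists the truth values of [t = t'], [t+1 = t'], [t = t'+1], [j = j'],
   [j+1 = j'] and [j = j'+1] for the grid positions (t,j) and (t',j'). *)
Definition shift_eq (rel : seq bool) (i : nat) (b b' : bool) : bool :=
  if b == b' then nth false rel i else
  if b then nth false rel i.+1 else nth false rel i.+2.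

Definition end_eq (A : finType) (rel : seq bool) (e e' : option bool * label A) : bool :=
  [&& shift_eq rel 0 (e.1 == Some true) (e'.1 == Some true),
      shift_eq rel 3 (e.1 == Some false) (e'.1 == Some false) & e.2 == e'.2].

Section AdjBit.
Variable M : TM.
Local Notation A := (cellval M).
Definition val0 : A :=
  (@tm_start M, @tm_blank M, (@tm_blank M, @tm_blank M, @tm_blank M)).
(** Any value different from [val0] would do: it shows that a cell has two selectors. *)
Definition val1 : A :=
  (@tm_start M, @tm_b0 M, (@tm_blank M, @tm_blank M, @tm_blank M)).

(** Only the relative position of the two cells matters for comparing ends, so this is a function on
    a finite domain, independent of the size of the grid. *)
Definition adjbit (k k' : slot A) (kd kd' rel : seq bool) : bool :=
  let src := (None, slot_src val0 (@cell_conf M kd) k) in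
  let tgt := slot_tgt val0 (@cell_conf M kd) k in
  let src' := (None, slot_src val0 (@cell_conf M kd') k') in
  let tgt' := slot_tgt val0 (@cell_conf M kd') k' in
  ~~ [&& nth false rel 0, nth false rel 3 & k == k'] &&
  [|| end_eq rel src src', end_eq rel src tgt', end_eq rel tgt src' |
      end_eq rel tgt tgt'].
End AdjBit.

Lemma iota_mul a b :
  iota 0 (a * b) = flatten [seq [seq i * b + j | j <- iota 0 b] | i <- iota 0 a].
Proof.
elim: a => // a IH; rewrite mulSnr iotaD IH -[a.+1]addn1 iotaD map_cat flatten_cat /=.
by rewrite cats0 !add0n -{1}[a * b]addn0 iotaDl.
Qed.

Lemma flatten_map_flatten (T U : Type) (f : T -> seq U) ss :
  flatten (map f (flatten ss)) = flatten [seq flatten (map f s) | s <- ss].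
Proof. by elim: ss => //= s ss IH; rewrite map_cat flatten_cat IH. Qed.

Section GridGraph.
Variables (M : TM) (x : seq bool) (W0 T : nat).
Local Notation A := (cellval M).
Local Notation K := (slot A).
Local Notation gridV := (gridV T).
Local Notation cS := (cS T).
Local Notation cW := (cW T).

Definition nslots := #|K|.
Definition nverts := cS * cW * nslots.

Lemma slot_rank_lt (k : K) : enum_rank k < nslots. Proof. exact: ltn_ord. Qed.

Lemma vert_lt (v : gridV) (k : K) : (v.1 * cW + v.2) * nslots + enum_rank k < nverts.
Proof.
have h1 : v.1 * cW + v.2 < cS * cW.
  apply: (@leq_trans (v.1.+1 * cW)); first by rewrite mulSnr ltn_add2l ltn_ord.
  by rewrite leq_mul2r ltn_ord orbT.
apply: (@leq_trans ((v.1 * cW + v.2).+1 * nslots)).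
  by rewrite mulSnr ltn_add2l ltn_ord.
by rewrite leq_mul2r h1 orbT.
Qed.

Definition vmk (v : gridV) (k : K) : 'I_nverts := Ordinal (vert_lt v k).
Definition vvar (e : 'I_nverts) : gridV :=
  (inord (e %/ nslots %/ cW) : 'I_T.+1, inord (e %/ nslots %% cW) : 'I_(cS + cS).+1).
Definition vslot (e : 'I_nverts) : K := nth (inl (inl (val0 M))) (enum K) (e %% nslots).

Lemma nslots_gt0 : 0 < nslots.
Proof. by apply: leq_ltn_trans (slot_rank_lt (inl (inl (val0 M)))). Qed.

Lemma vmk_var v k : vvar (vmk v k) = v.
Proof.
have e1 : ((v.1 * cW + v.2) * nslots + enum_rank k) %/ nslots = v.1 * cW + v.2.
  by rewrite divnMDl ?nslots_gt0 // divn_small ?slot_rank_lt ?addn0.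
rewrite /vvar /= e1 divnMDl // modnMDl (divn_small (ltn_ord v.2)) modn_small ?ltn_ord // addn0.
by case: v {e1} => t j; congr pair; apply: val_inj; rewrite /= inordK ?ltn_ord.
Qed.

Lemma vmk_slot v k : vslot (vmk v k) = k.
Proof.
rewrite /vslot /= modnMDl modn_small ?slot_rank_lt //.
by rewrite nth_enum_rank.
Qed.

Lemma vvar_vslot e : vmk (vvar e) (vslot e) = e.
Proof.
apply: val_inj => /=.
have lt : e %/ nslots %/ cW < T.+1.
  by rewrite !ltn_divLR ?nslots_gt0 // ltn_ord.
rewrite !inordK ?ltn_mod // -divn_eq /vslot.
have lt2 : e %% nslots < #|K| by rewrite ltn_mod nslots_gt0.
by rewrite -[e %% nslots]/(val (Ordinal lt2)) -enum_val_nth enum_valK -divn_eq.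
Qed.

Definition grid_adj : rel 'I_nverts :=
  conflict_adj (val0 M) (@grid_nb T) (@grid_conf M x W0 T) vvar vslot.

Definition vert (t j : nat) (k : K) : 'I_nverts := vmk (gridv T t j) k.

(** Mixed-radix numbering lists the vertices in the order of nested loops over rows, columns and
    slots, which is the order of printing. *)
Lemma enum_verts : enum 'I_nverts =
  flatten [seq flatten [seq [seq vert t j k | k <- enum K] | j <- iota 0 cW]
          | t <- iota 0 cS].
Proof.
have rankE : iota 0 nslots = [seq val (enum_rank k) | k <- enum K].
  have sK : size (enum K) = nslots by rewrite /nslots cardE.
  apply: (@eq_from_nth _ 0) => [|i]; rewrite size_iota; first by rewrite size_map sK.
  move=> lt; rewrite nth_iota // (nth_map (inl (inl (val0 M)))) ?sK //.
  by rewrite -[i]/(val (Ordinal lt)) -enum_val_nth enum_valK.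
have vertE t j : t < cS -> j < cW -> [seq val (vert t j k) | k <- enum K] =
    [seq (t * cW + j) * nslots + i | i <- iota 0 nslots].
  move=> lt lj; rewrite rankE -[RHS]map_comp; apply: eq_map => k.
  by rewrite [LHS]/(_ + _) /= !inordK.
apply: (inj_map val_inj); rewrite val_enum_ord /nverts iota_mul iota_mul.
rewrite flatten_map_flatten map_flatten -[in LHS]map_comp -[in RHS]map_comp; congr flatten.
apply/eq_in_map=> t; rewrite mem_iota add0n => /andP[_ lt]; rewrite /comp.
rewrite map_flatten -[in LHS]map_comp -[in RHS]map_comp; congr flatten.
apply/eq_in_map=> j; rewrite mem_iota add0n => /andP[_ lj]; rewrite /comp.
by rewrite -[RHS]map_comp; apply/esym/(vertE t j lt lj).
Qed.

Lemma map_verts (U : Type) (f : 'I_nverts -> U) : [seq f e | e <- enum 'I_nverts] =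
  flatten [seq flatten [seq [seq f (vert t j k) | k <- enum K] | j <- iota 0 cW]
          | t <- iota 0 cS].
Proof.
rewrite enum_verts map_flatten -[LHS]/(flatten _) -map_comp; congr flatten.
apply: eq_map => t; rewrite /comp map_flatten -map_comp; congr flatten.
by apply: eq_map => j; rewrite /comp -map_comp.
Qed.

Definition grid_rel (t j t' j' : nat) : seq bool :=
  [:: t == t'; t.+1 == t'; t == t'.+1; j == j'; j.+1 == j'; j == j'.+1].

Lemma shift_eqE (t j t' j' : nat) (b b' c c' : bool) :
  shift_eq (grid_rel t j t' j') 0 b b' = (t + b == t' + b') /\
  shift_eq (grid_rel t j t' j') 3 c c' = (j + c == j' + c').
Proof.
by rewrite /shift_eq; split; [case: b b' => -[]|case: c c' => -[]] => /=;
  rewrite ?addn0 ?addn1 ?eqSS.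
Qed.

(** Conflicts to the right or downwards exist only where [k_right] or [k_down] holds, so the
    clipping of [grid_nb] at the border never acts on an edge. *)
Lemma slot_tgt_val (v : gridV) k :
  let d := (slot_tgt (val0 M) (@grid_conf M x W0 T v) k).1 in
  ((grid_nb v d).1 = v.1 + (d == Some true) :> nat) *
  ((grid_nb v d).2 = v.2 + (d == Some false) :> nat).
Proof.
case: k => [[s|[s a]]|[[d a] b]] /=; rewrite ?addn0 //.
case: ifP => [|_] /=; last by rewrite !addn0.
case: d => [[]|] /=; rewrite ?addn0 ?addn1 // => /andP[].
  by rewrite /k_down /= => lt _; rewrite val_insubd lt.
by rewrite /k_right /= => lt _; rewrite val_insubd lt.
Qed.

Lemma grid_adjE t j k t' j' k' : t < cS -> j < cW -> t' < cS -> j' < cW ->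
  grid_adj (vert t j k) (vert t' j' k') =
  adjbit k k' (kind x W0 T t j) (kind x W0 T t' j') (grid_rel t j t' j').
Proof.
move=> lt lj lt' lj'; rewrite /grid_adj /conflict_adj /vert.
set v := gridv T t j; set v' := gridv T t' j'.
have [vt vj] : v.1 = t :> nat /\ v.2 = j :> nat by rewrite /= !inordK.
have [vt' vj'] : v'.1 = t' :> nat /\ v'.2 = j' :> nat by rewrite /= !inordK.
clearbody v v'.
have eqv u u' : (u == u' :> gridV) = (u.1 == u'.1 :> nat) && (u.2 == u'.2 :> nat).
  by case: u u' => a b [a' b'].
have -> : (vmk v k != vmk v' k') = ~~ [&& t == t', j == j' & k == k'].
  congr negb; apply/eqP/and3P=> [H|[/eqP e1 /eqP e2 /eqP->]].
    have := congr1 vvar H; have := congr1 vslot H; rewrite !vmk_slot !vmk_var => -> Hv.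
    by rewrite -vt -vt' -vj -vj' Hv !eqxx.
  by congr vmk; apply/eqP; rewrite eqv vt vt' vj vj' e1 e2 !eqxx.
rewrite /adjbit; congr andb; rewrite /share /esrc /etgt !vmk_var !vmk_slot.
have := slot_tgt_val v k; have := slot_tgt_val v' k'.
rewrite /grid_conf vt vj vt' vj'.
case: (slot_tgt _ _ k) => d l; case: (slot_tgt _ _ k') => d' l' /= [h1' h2'] [h1 h2].
rewrite !xpair_eqE !eqv h1 h2 h1' h2' vt vj vt' vj' /end_eq /=.
have E b b' c c' := shift_eqE t j t' j' b b' c c'.
rewrite !(E _ _ false false).1 !(E false false _ _).2.
by rewrite -![None == Some _]/false !addn0 !andbA.
Qed.

Lemma enc_grid_adj : enc_graph grid_adj =
  flatten [seq flatten [seq nseq nslots true | j <- iota 0 cW] | t <- iota 0 cS] ++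
  false :: flatten [seq flatten [seq flatten [seq
    flatten [seq flatten [seq
      [seq adjbit k k' (kind x W0 T t j) (kind x W0 T t' j') (grid_rel t j t' j')
      | k' <- enum K] | j' <- iota 0 cW] | t' <- iota 0 cS]
    | k <- enum K] | j <- iota 0 cW] | t <- iota 0 cS].
Proof.
rewrite /enc_graph; congr (_ ++ _ :: _).
  have nsq (U : eqType) (r : seq U) c : flatten [seq nseq c true | i <- r] = nseq (size r * c) true.
    by elim: r => //= i r ->; rewrite mulSn nseqD.
  by rewrite nsq size_iota nsq size_iota /nverts mulnA.
rewrite /allpairs_dep -[LHS]/(flatten [seq [seq grid_adj i j | j <- enum 'I_nverts]
  | i <- enum 'I_nverts]).
have ff (U : Type) (ss : seq (seq (seq U))) : flatten (flatten ss) = flatten (map flatten ss).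
  by elim: ss => //= s ss IH; rewrite flatten_cat IH.
rewrite map_verts ff -map_comp; congr flatten.
apply/eq_in_map=> t; rewrite mem_iota add0n => /andP[_ lt]; rewrite /comp.
rewrite ff -map_comp; congr flatten.
apply/eq_in_map=> j; rewrite mem_iota add0n => /andP[_ lj]; rewrite /comp.
congr flatten; apply: eq_map => k; rewrite map_verts; congr flatten.
apply/eq_in_map=> t'; rewrite mem_iota add0n => /andP[_ lt']; congr flatten.
apply/eq_in_map=> j'; rewrite mem_iota add0n => /andP[_ lj'].
by apply: eq_map => k'; rewrite grid_adjE.
Qed.

Hypothesis bl0 : @tm_blank M != @tm_b0 M.
Hypothesis bl1 : @tm_blank M != @tm_b1 M.
Hypothesis b01 : @tm_b0 M != @tm_b1 M.
Hypothesis leT : 2 * size x + 2 + W0 <= T.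

Lemma grid_adj_simple : simple_graph grid_adj.
Proof. by split; [apply: conflict_adj_irr|apply: conflict_adj_sym]. Qed.

Lemma grid_adj_claw_free : claw_free grid_adj.
Proof.
case=> e [a [b [c /and5P[xa xb xc ab /and5P[ac bc nab nac nbc]]]]].
have := conflict_adj_no_claw xa xb xc ab ac bc.
by rewrite -/grid_adj (negbTE nab) (negbTE nac) (negbTE nbc).
Qed.

Lemma grid_adj_ct : ct_gt2_le1 [set: 'I_nverts] grid_adj <->
  ~ exists w, size w <= W0 /\ tm_output (tm_run T (tm_init M (enc_pair x w))) = [:: true].
Proof.
have n01 : val0 M != val1 M by rewrite !xpair_eqE (negbTE bl0) andbF.
have self (v : gridV) a b : a != b -> @grid_conf M x W0 T v None a b by rewrite /grid_conf /= => ->.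
have := conflict_graph_ct n01 (fun=> erefl) self vmk_var vmk_slot
  (tableau_almost_sat bl0 bl1 b01 leT).
rewrite -/grid_adj => ->; have tS := tableau_sat bl0 bl1 b01 leT.
by split=> H /tS.
Qed.

Lemma grid_adj_connected : connected_graph grid_adj.
Proof.
have sym : connect_sym grid_adj by apply: sym_connect_sym; apply: conflict_adj_sym.
(* At the border [grid_nb] returns the cell itself; elsewhere [None] conflicts with everything. *)
have none (v : gridV) d b : grid_nb v d != v -> @grid_conf M x W0 T v d None b.
  case: d => [[]|] /=; last by rewrite eqxx.
    case: (ltnP v.1.+1 cS) => [lt _|le]; first by rewrite /grid_conf /= /k_down /= lt.
    rewrite (_ : insubd _ _ = v.1) -?surjective_pairing ?eqxx //.
    by apply: val_inj; rewrite val_insubd ltnNge le.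
  case: (ltnP v.2.+1 cW) => [lt _|le]; first by rewrite /grid_conf /= /k_right /= lt.
  rewrite (_ : insubd _ _ = v.2) -?surjective_pairing ?eqxx //.
  by apply: val_inj; rewrite val_insubd ltnNge le.
have nbc v d k k' : connect grid_adj (vmk v k) (vmk (grid_nb v d) k').
  exact: (conflict_adj_nb_connect (val0 M) (fun=> erefl) vmk_var vmk_slot none).
have vc v k k' : connect grid_adj (vmk v k) (vmk v k').
  exact: (conflict_adj_var_connect (val0 M) (@grid_conf M x W0 T) (fun=> erefl) vmk_var vmk_slot).
set k0 : K := inl (inl (val0 M)).
have row0 j : j < cW -> connect grid_adj (vmk (gridv T 0 0) k0) (vmk (gridv T 0 j) k0).
  elim: j => [|j IHj] lj; first exact: connect0.
  rewrite -gridv_right //.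
  exact: (connect_trans (IHj (ltnW lj)) (nbc _ (Some false) k0 k0)).
have grid t j : t < cS -> j < cW ->
    connect grid_adj (vmk (gridv T 0 0) k0) (vmk (gridv T t j) k0).
  move=> + lj; elim: t => [|t IHt] lt; first exact: row0.
  rewrite -gridv_down //.
  exact: (connect_trans (IHt (ltnW lt)) (nbc _ (Some true) k0 k0)).
have all e : connect grid_adj (vmk (gridv T 0 0) k0) e.
  have gE (v : gridV) : v = gridv T v.1 v.2.
    by case: v => t j; congr pair; apply: val_inj; rewrite /= inordK.
  rewrite -(vvar_vslot e) [vvar e]gE.
  by apply: (connect_trans (grid _ _ _ _) (vc _ k0 _)); rewrite ltn_ord.
by move=> e f; apply: connect_trans (all f); rewrite sym.
Qed.
End GridGraph.

(** * The program printing the adjacency matrix *)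

Definition reg : finType := 'I_27.
Local Notation "'#r' k" := (@Ordinal 27 k isT) (at level 5, k at level 4).
Definition rN : reg := #r 0.
Definition rN1 : reg := #r 1.
Definition rW0 : reg := #r 2.
Definition rB : reg := #r 3.
Definition rB1 : reg := #r 4.
Definition rT : reg := #r 5.
Definition rS : reg := #r 6.
Definition rS1 : reg := #r 7.
Definition rE : reg := #r 8.
Definition rE1 : reg := #r 9.
Definition rF : reg := #r 10.
Definition rW : reg := #r 11.
Definition rZ : reg := #r 12.
Definition rt : reg := #r 13.
Definition rj : reg := #r 14.
Definition rt1 : reg := #r 15.
Definition rj1 : reg := #r 16.
Definition ry : reg := #r 17.
Definition rt' : reg := #r 18.
Definition rj' : reg := #r 19.
Definition rt1' : reg := #r 20.
Definition rj1' : reg := #r 21.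
Definition ry' : reg := #r 22.
Definition tmp : reg := #r 23.
Definition m1 : reg := #r 24.
Definition m2 : reg := #r 25.
Definition m3 : reg := #r 26.

Ltac mem_tac :=
  repeat first [by rewrite inE eqxx | apply: mem_aset; [by [] |] | rewrite inE; apply/orP; right].

Ltac sub_tac :=
  apply/allP; rewrite /=; repeat (apply/andP; split; first by mem_tac); done.

Definition grid_env T S E F W : env reg :=
  [:: (rT, T); (rS, S); (rS1, S.+1); (rE, E); (rE1, E.+1); (rF, F); (rW, W); (rZ, 0)].

Definition pprep (t j t1 j1 y : reg) : prog reg :=
  pseq (pcopy t1 t) (pseq (pinc t1) (pseq (pcopy j1 j) (pseq (pinc j1)
  (pseq (pzero y) (pseq (pcopy tmp rS1)
  (pwhile (TLt tmp j) (pseq (pinc tmp) (pseq (pinc tmp) (pinc y))))))))).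
Definition cprep S W := 20 + 4 * S + 8 * W.

Lemma hoare_half x al y j S v : y != tmp -> j != tmp -> j != y -> (j, v) \in al ->
  let h := (v - S)./2 in
  hoare x (aset tmp S.+1 (aset y 0 al))
    (pwhile (TLt tmp j) (pseq (pinc tmp) (pseq (pinc tmp) (pinc y))))
    (aset tmp (S.+1 + 2 * h) (aset y h al)) [::] (h * (1 + (1 + 1)).+1).+1.
Proof.
move=> yt jt jy jv h; have ty : tmp != y by rewrite eq_sym.
rewrite -[S.+1 in X in hoare _ X]addn0 -{1}(muln0 2).
rewrite -(flatten_nil _ (iota 0 h)).
apply: (hoare_while (al := fun k => aset tmp (S.+1 + 2 * k) (aset y k al))) => [k s le hs|k lt].
  rewrite /= (hs (tmp, S.+1 + 2 * k)) ?(hs (j, v)) /=; first by rewrite /h; lia.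
    by do 2 apply: mem_aset => //.
  by rewrite inE eqxx.
set u := S.+1 + 2 * k.
apply: (hoare_post (al0 := aset y k.+1 (aset tmp u.+2 (aset tmp u.+1 (aset tmp u (aset y k al)))))).
  move=> p; rewrite !aset_aset (_ : S.+1 + 2 * k.+1 = u.+2); last by rewrite /u; lia.
  rewrite !(inE, mem_filter).
  case: (p =P (tmp, u.+2)) => [->|_] /=; first by rewrite ty orbT.
  by case: (p =P (y, k.+1)) => //= _ /and3P[-> -> ->]; rewrite !orbT.
rewrite -[[::]]/([::] ++ ([::] ++ [::])).
apply: hoare_seq; first by apply: (@hoare_inc _ _ _ _ u); rewrite inE eqxx.
apply: hoare_seq; first by apply: (@hoare_inc _ _ _ _ u.+1); rewrite inE eqxx.
by apply: hoare_inc; do 3 apply: mem_aset => //; rewrite inE eqxx.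
Qed.

Ltac prep_tac vt vj S :=
  apply: (@hoare_cost _ _ _ _ _ _ ((1 + (vt * 2).+1) + (1 + ((1 + (vj * 2).+1) + (1 + (1 +
    ((1 + (S.+1 * 2).+1) + ((vj - S)./2 * (1 + (1 + 1)).+1).+1))))))); first
    (by rewrite /cprep; lia);
  rewrite -[[::]]/([::] ++ ([::] ++ ([::] ++ ([::] ++ ([::] ++ ([::] ++ [::]))))));
  apply: hoare_seq; first (by apply: hoare_copy; [|mem_tac]);
  apply: hoare_seq; first (by apply: (@hoare_inc _ _ _ _ vt); mem_tac);
  apply: hoare_seq; first (by apply: (@hoare_copy _ _ _ _ _ vj); [|mem_tac]);
  apply: hoare_seq; first (by apply: (@hoare_inc _ _ _ _ vj); mem_tac);
  apply: hoare_seq; first (by apply: hoare_zero);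
  apply: hoare_seq; first (by apply: (@hoare_copy _ _ _ _ _ S.+1); [|mem_tac]).

Lemma hoare_prep1 x T S E F W vt vj : vt <= S -> vj <= W ->
  let al := [:: (rj, vj), (rt, vt) & grid_env T S E F W] in
  hoare x al (pprep rt rj rt1 rj1 ry)
    [:: (rt1, vt.+1), (rj1, vj.+1), (ry, (vj - S)./2) & al] [::] (cprep S W).
Proof.
move=> lt lj al; prep_tac vt vj S.
by apply: hoare_post (@hoare_half _ _ _ _ S vj _ _ _ _) => //; [sub_tac|mem_tac].
Qed.

Lemma hoare_prep2 x T S E F W vt vj ut uj h : vt <= S -> vj <= W ->
  let al := [:: (rj', vj), (rt', vt), (rt1, ut.+1), (rj1, uj.+1), (ry, h), (rj, uj), (rt, ut)
              & grid_env T S E F W] in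
  hoare x al (pprep rt' rj' rt1' rj1' ry')
    [:: (rt1', vt.+1), (rj1', vj.+1), (ry', (vj - S)./2) & al] [::] (cprep S W).
Proof.
move=> lt lj al; prep_tac vt vj S.
by apply: hoare_post (@hoare_half _ _ _ _ S vj _ _ _ _) => //; [sub_tac|mem_tac].
Qed.

Definition kind_tests (t j t1 j1 y : reg) : seq (test reg) :=
  [:: TEq t rZ; TEq t rT; TLt j rS; TEq j rT; TEq j rS; TEq j rS1; TLt j rE; TEq j rE;
      TEq j rE1; TLt j rF; TBit y; TLt j1 rW; TLt t1 rS].

Definition rel_tests : seq (test reg) :=
  [:: TEq rt rt'; TEq rt1 rt'; TEq rt rt1'; TEq rj rj'; TEq rj1 rj'; TEq rj rj1'].

Definition all_tests : seq (test reg) :=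
  kind_tests rt rj rt1 rj1 ry ++ kind_tests rt' rj' rt1' rj1' ry' ++ rel_tests.

(** Only positions are counted in registers; the loops over slots are unrolled. The cuts at 13 and
    26 separate the two kinds and the relative position. *)
Definition pairs_prog (K : finType) (bit : K -> K -> seq bool -> seq bool -> seq bool -> bool) :
    prog reg :=
  pfor rt rS (pfor rj rW (pseq (pprep rt rj rt1 rj1 ry)
    (pseqs (fun k : K =>
      pfor rt' rS (pfor rj' rW (pseq (pprep rt' rj' rt1' rj1' ry')
        (gather all_tests (fun bs =>
          pouts reg [seq bit k k' (take 13 bs) (take 13 (drop 13 bs)) (drop 26 bs)
                | k' <- enum K]))))) (enum K)))).

Definition cinner S W K := cfor S (cfor W (cprep S W + (size all_tests + K))).
Definition cpairs S W K := cfor S (cfor W (cprep S W + K * cinner S W K)).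

Lemma hoare_pairs (K : finType) bit x W0 T :
  let al := grid_env T (cS T) (cE x T) (cF x W0 T) (cW T) in
  hoare x al (@pairs_prog K bit) al
    (flatten [seq flatten [seq flatten [seq
      flatten [seq flatten [seq
        [seq bit k k' (kind x W0 T t j) (kind x W0 T t' j') (grid_rel t j t' j')
        | k' <- enum K] | j' <- iota 0 (cW T)] | t' <- iota 0 (cS T)]
      | k <- enum K] | j <- iota 0 (cW T)] | t <- iota 0 (cS T)])
    (cpairs (cS T) (cW T) #|K|).
Proof.
move=> al; apply: hoare_for => [//||t lt]; first by mem_tac.
apply: hoare_for => [//||j lj]; first by mem_tac.
rewrite -[flatten _]cat0s.
apply: hoare_seq; first by apply: hoare_prep1; exact: ltnW.
apply: (hoare_post (al0 := [:: (rt1, t.+1), (rj1, j.+1), (ry, (j - cS T)./2), (rj, j), (rt, t) & al])).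
  by sub_tac.
rewrite cardE; apply: hoare_seqs => k.
apply: hoare_for => [//||t' lt']; first by mem_tac.
apply: hoare_for => [//||j' lj']; first by mem_tac.
rewrite -[[seq _ | _ <- _]]cat0s.
apply: hoare_seq; first by apply: hoare_prep2; exact: ltnW.
set al2 := (X in hoare _ X).
apply: (hoare_post (al0 := al2)); first by rewrite /al2; sub_tac.
apply: (@hoare_gather _ _ _ _ _
  (kind x W0 T t j ++ kind x W0 T t' j' ++ grid_rel t j t' j')).
  move=> s hs.
  have H r v : (r, v) \in al2 -> regs s r = v by move/hs.
  rewrite /= (H rt t) ?(H rj j) ?(H rt1 t.+1) ?(H rj1 j.+1) ?(H ry (j - cS T)./2);
    try by rewrite /al2; mem_tac.
  rewrite (H rt' t') ?(H rj' j') ?(H rt1' t'.+1) ?(H rj1' j'.+1) ?(H ry' (j' - cS T)./2);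
    try by rewrite /al2; mem_tac.
  rewrite (H rT T) ?(H rS (cS T)) ?(H rS1 (cS T).+1) ?(H rE (cE x T)) ?(H rE1 (cE x T).+1);
    try by rewrite /al2; mem_tac.
  by rewrite (H rF (cF x W0 T)) ?(H rW (cW T)) ?(H rZ 0) //; rewrite /al2; mem_tac.
rewrite -[X in hoare _ _ _ _ _ X](size_map (fun k' => bit k k' (kind x W0 T t j) (kind x W0 T t' j')
  (grid_rel t j t' j')) (enum K)).
exact: hoare_outs.
Qed.

(** * The reduction *)

Section Setup.
Variables k kt : nat.
Definition wit_bound n := k * n.+1 ^ k.
Definition pair_bound n := (wit_bound n + n + n).+2.
(** The successors keep this at least [pair_bound n] even when [kt] is 0, so that the encoded pair
    fits into the grid. *)
Definition time_bound n := kt.+1 * (pair_bound n).+1 ^ kt.+1.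

Lemma polyb_succ f : polyb f -> polyb (fun n => (f n).+1).
Proof. by move=> pf; apply: polyb_le (polyb_add pf (polyb_const 1)) => n; rewrite addn1. Qed.

Lemma polyb_wit_bound : polyb wit_bound.
Proof. exact: polyb_mul (polyb_const k) (polyb_exp k (polyb_succ polyb_id)). Qed.
Lemma polyb_pair_bound : polyb pair_bound.
Proof.
by do 2 apply: polyb_succ; do 2 apply: polyb_add polyb_id; apply: polyb_wit_bound.
Qed.
Lemma polyb_time_bound : polyb time_bound.
Proof. exact: polyb_mul (polyb_const _) (polyb_exp _ (polyb_succ polyb_pair_bound)). Qed.

Definition setup_prog : prog reg :=
  foldr (@pseq reg) (@pskip reg)
  [:: pwhile (TIn rN) (pinc rN); pcopy rN1 rN; pinc rN1;
      piter k (pinc rW0); piter k (pmul m1 m2 m3 rW0 rN1);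
      pcopy rB rW0; padd tmp rB rN; padd tmp rB rN; pinc rB; pinc rB;
      pcopy rB1 rB; pinc rB1;
      piter kt.+1 (pinc rT); piter kt.+1 (pmul m1 m2 m3 rT rB1);
      pcopy rS rT; pinc rS; pcopy rS1 rS; pinc rS1;
      pcopy rE rS; padd tmp rE rN; padd tmp rE rN; pcopy rE1 rE; pinc rE1;
      pcopy rF rS; padd tmp rF rB; pcopy rW rS1; padd tmp rW rS].

Definition env0 : env reg := [:: (rN, 0); (rW0, 0); (rT, 0); (rZ, 0)].

Definition setup_env n : env reg :=
  let T := time_bound n in
  grid_env T T.+1 (T.+1 + n + n) (T.+1 + pair_bound n) (T.+2 + T.+1).

Lemma phoare_setup : phoare (fun=> env0) setup_prog setup_env.
Proof.
have pI := polyb_id; have pW := polyb_wit_bound; have pB := polyb_pair_bound.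
have pT := polyb_time_bound; have pS := polyb_succ pT; have pS1 := polyb_succ pS.
have pB1 := polyb_succ pB; have pN1 := polyb_succ pI.
have pE : polyb (fun n => (time_bound n).+1 + n + n) by do 2 apply: polyb_add => //.
rewrite /setup_prog.
apply: phoare_seq; first by apply: phoare_size => n; mem_tac.
apply: phoare_seq; first by apply: (phoare_copy (v := id)) => // n; mem_tac.
apply: phoare_seq; first by apply: (phoare_inc (v := id)) => n; mem_tac.
apply: phoare_seq; first by apply: phoare_piter_inc => n; mem_tac.
apply: phoare_seq.
  by apply: (phoare_pow (a := fun=> k) (b := fun n => n.+1)) => //;
    [move=> n; rewrite disjoint_has | apply: polyb_const | move=> n; mem_tac | move=> n; mem_tac].
apply: phoare_seq; first by apply: (phoare_copy (v := wit_bound)) => // n; mem_tac.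
apply: phoare_seq.
  by apply: (phoare_add (a := wit_bound) (b := id)) => // n; mem_tac.
apply: phoare_seq.
  by apply: (phoare_add (a := fun n => wit_bound n + n) (b := id)) => // n; mem_tac.
apply: phoare_seq.
  by apply: (phoare_inc (v := fun n => wit_bound n + n + n)) => n; mem_tac.
apply: phoare_seq.
  by apply: (phoare_inc (v := fun n => (wit_bound n + n + n).+1)) => n; mem_tac.
apply: phoare_seq; first by apply: (phoare_copy (v := pair_bound)) => // n; mem_tac.
apply: phoare_seq; first by apply: (phoare_inc (v := pair_bound)) => n; mem_tac.
apply: phoare_seq; first by apply: phoare_piter_inc => n; mem_tac.
apply: phoare_seq.
  by apply: (phoare_pow (a := fun=> kt.+1) (b := fun n => (pair_bound n).+1)) => //;
    [move=> n; rewrite disjoint_has | apply: polyb_const | move=> n; mem_tac | move=> n; mem_tac].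
apply: phoare_seq; first by apply: (phoare_copy (v := time_bound)) => // n; mem_tac.
apply: phoare_seq; first by apply: (phoare_inc (v := time_bound)) => n; mem_tac.
apply: phoare_seq.
  by apply: (phoare_copy (v := fun n => (time_bound n).+1)) => // n; mem_tac.
apply: phoare_seq.
  by apply: (phoare_inc (v := fun n => (time_bound n).+1)) => n; mem_tac.
apply: phoare_seq.
  by apply: (phoare_copy (v := fun n => (time_bound n).+1)) => // n; mem_tac.
apply: phoare_seq.
  by apply: (phoare_add (a := fun n => (time_bound n).+1) (b := id)) => // n; mem_tac.
apply: phoare_seq.
  by apply: (phoare_add (a := fun n => (time_bound n).+1 + n) (b := id)) => // n; mem_tac.
apply: phoare_seq.
  by apply: (phoare_copy (v := fun n => (time_bound n).+1 + n + n)) => // n; mem_tac.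
apply: phoare_seq.
  by apply: (phoare_inc (v := fun n => (time_bound n).+1 + n + n)) => n; mem_tac.
apply: phoare_seq.
  by apply: (phoare_copy (v := fun n => (time_bound n).+1)) => // n; mem_tac.
apply: phoare_seq.
  by apply: (phoare_add (a := fun n => (time_bound n).+1) (b := pair_bound)) => // n; mem_tac.
apply: phoare_seq.
  by apply: (phoare_copy (v := fun n => (time_bound n).+2)) => // n; mem_tac.
apply: phoare_seq.
  by apply: (phoare_add (a := fun n => (time_bound n).+2) (b := fun n => (time_bound n).+1)) => //
    n; mem_tac.
apply: phoare_sub; last exact: phoare_skip.
by move=> n; sub_tac.
Qed.
End Setup.

Section Reduction.
Variables (M : TM) (k kt : nat).
Local Notation W0 x := (wit_bound k (size x)).
Local Notation T x := (time_bound k kt (size x)).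

Definition reduction (x : seq bool) : seq bool := enc_graph (@grid_adj M x (W0 x) (T x)).

Definition reduction_prog : prog reg :=
  pseq (setup_prog k kt)
  (pseq (pfor rt rS (pfor rj rW (pouts reg (nseq (nslots M) true))))
  (pseq (pout reg false) (pairs_prog (@adjbit M)))).

Lemma setup_envE x : setup_env k kt (size x) =
  grid_env (T x) (cS (T x)) (cE x (T x)) (cF x (W0 x) (T x)) (cW (T x)).
Proof.
rewrite /setup_env; set n := size x; set t := time_bound k kt n.
have -> : t.+1 + n + n = cE x t by rewrite /cE /cS -/n; lia.
have -> : t.+1 + pair_bound k n = cF x (wit_bound k n) t.
  by rewrite /cF /cS /pair_bound -/n; lia.
by have -> : t.+2 + t.+1 = cW t by rewrite /cW /cS; lia.
Qed.

Lemma polyb_cprep f g : polyb f -> polyb g -> polyb (fun n => cprep (f n) (g n)).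
Proof.
move=> pf pg; apply: polyb_add (polyb_mul (polyb_const 8) pg).
exact: polyb_add (polyb_const 20) (polyb_mul (polyb_const 4) pf).
Qed.

Lemma reduction_poly_time : poly_time reduction.
Proof.
have [C1 pC1 h1] := phoare_setup k kt.
pose S n := cS (time_bound k kt n); pose W n := cW (time_bound k kt n).
have pS : polyb S by apply: polyb_succ; apply: polyb_time_bound.
have pW : polyb W by apply: polyb_succ; apply: polyb_add.
pose K := nslots M.
apply: (@prog_poly_time _ reduction_prog (fun n => C1 n + (cfor (S n) (cfor (W n) K) +
  (1 + cpairs (S n) (W n) K)))).
  have pK : polyb (fun=> K) by apply: polyb_const.
  have pP := polyb_cprep pS pW.
  apply: polyb_add => //; apply: polyb_add; first by do 2 apply: polyb_cfor => //.
  apply: polyb_add; first exact: polyb_const.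
  do 2 apply: polyb_cfor => //; apply: polyb_add => //; apply: polyb_mul => //.
  do 2 apply: polyb_cfor => //; apply: polyb_add => //.
  exact: polyb_const.
move=> x; have H := h1 x; rewrite setup_envE in H.
have hr : hoare x env0 reduction_prog
    (grid_env (T x) (cS (T x)) (cE x (T x)) (cF x (W0 x) (T x)) (cW (T x)))
    (reduction x) (C1 (size x) + (cfor (S (size x)) (cfor (W (size x)) K) +
      (1 + cpairs (S (size x)) (W (size x)) K))).
  rewrite /reduction enc_grid_adj -[X in hoare _ _ _ _ X]cat0s.
  apply: hoare_seq H _; apply: hoare_seq.
    apply: hoare_for => [//||t lt]; first by mem_tac.
    apply: hoare_for => [//||j lj]; first by mem_tac.
    by rewrite -[X in hoare _ _ _ _ _ X](size_nseq K true); apply: hoare_outs.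
  rewrite -cat1s; apply: hoare_seq; first exact: hoare_out.
  exact: hoare_pairs.
have [|c [s [h2 h3 _ h5]]] := hr (pinit reg).
  by move=> p; rewrite !inE => /or4P[] /eqP->.
by exists c, s; split.
Qed.
End Reduction.

Lemma tm_run_halted (M : TM) (c : config M) t t' :
  @tm_halt M (tm_state_of (tm_run t c)) -> t <= t' -> tm_run t' c = tm_run t c.
Proof.
move=> h le; rewrite -(subnK le) /tm_run iterD -/(tm_run t c).
elim: (t' - t) => //= m ->; case: (tm_run t c) h => [[[q l] a] r] /= h.
by rewrite h.
Qed.

(* 1-Edge Contraction(gamma_t2) restricted to claw-free (connected, simple)
   graphs is coNP-hard: every coNP language polynomial-time many-one reduces
   to it, the reduction always producing (encodings of) claw-free graphs. *)
Theorem theorem6 :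
  forall L : language, in_coNP L ->
  exists f : seq bool -> seq bool, poly_time f /\
    forall x : seq bool, exists (n : nat) (adj : rel 'I_n),
      [/\ f x = enc_graph adj, simple_graph adj, connected_graph adj,
          claw_free adj &
          (L x <-> ct_gt2_le1 [set: 'I_n] adj)].
Proof.
move=> L [Ver [k [[g [[M [kt [/and3P[bl0 bl1 b01] gM]]] gV]] LV]]].
exists (reduction M k kt); split; first exact: reduction_poly_time.
move=> x; set W0 := wit_bound k (size x); set T := time_bound k kt (size x).
exists (nverts M T), (@grid_adj M x W0 T).
have lePT : pair_bound k (size x) <= T.
  rewrite /T /time_bound expnS; set b := pair_bound _ _.
  have : 0 < b.+1 ^ kt by rewrite expn_gt0.
  nia.
have leT : 2 * size x + 2 + W0 <= T.
  by apply: leq_trans lePT; rewrite /pair_bound -/W0; lia.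
split=> //.
- exact: grid_adj_simple.
- exact: grid_adj_connected.
- exact: grid_adj_claw_free.
(* The verifier halts within its own bound, which is at most [T], and its configuration no longer
   changes. *)
have acc w : size w <= W0 ->
    (Ver (enc_pair x w) <-> tm_output (tm_run T (tm_init M (enc_pair x w))) = [:: true]).
  move=> sw; rewrite gV; have [t [tb [th <-]]] := gM (enc_pair x w).
  rewrite (tm_run_halted th) //; apply: leq_trans tb _; apply: leq_mul => //.
  have sz : size (enc_pair x w) <= pair_bound k (size x).
    rewrite /enc_pair !size_cat /= /pair_bound -/W0.
    suff -> : size (flatten [seq [:: b; b] | b <- x]) = 2 * size x by lia.
    by elim: (x) => //= b y ->; lia.
  apply: (@leq_trans ((pair_bound k (size x)).+1 ^ kt)); last exact: leq_pexp2l.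
  by case: (kt) => [|e]; rewrite ?expn0 // leq_exp2r.
have ctE := grid_adj_ct bl0 bl1 b01 leT.
split=> [Lx|/ctE nw].
  apply/ctE => -[w [sw /(acc _ sw) Vw]].
  by have /(_ Lx) := (LV x).2 (ex_intro _ w (conj sw Vw)).
(* Membership in coNP describes only the complement of [L], so [L x] itself is recovered
   classically. *)
apply: NNPP => /LV[w [sw Vw]]; apply: nw; exists w; split=> //.
by apply/(acc _ sw).
Qed.
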